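(* Let $\ell$ be an odd prime, and define \[ \gamma := \begin{cases} 5 & \text{if } \ell \equiv 3 \pmod 8,\\ 6 & \text{if } \ell \equiv 5,7 \pmod 8,\\ 7 & \text{if } \ell \equiv 1 \pmod 8.\end{cases} \] Then for every integer $n \geq 0$, \[ \overline{p}(\ell^{2}n) + \left(\frac{-n}{\ell}\right)\ell^{-2}\,\overline{p}(n) + \ell^{-3}\,\overline{p}(n/\ell^{2}) \equiv (1+\ell)\,\overline{p}(n) \pmod{16}, \] \[ \ell^{2}n\,\overline{p}(\ell^{2}n) + \left(\frac{-n}{\ell}\right) n\,\overline{p}(n) + \ell^{-1} n\,\overline{p}(n/\ell^{2}) \equiv (1+\ell)\, n\,\overline{p}(n) \pmod{2^{\gamma}}. \]
   Context: An overpartition of $n$ is a partition of $n$ in which the first occurrence of each distinct part may be overlined or not; $\overline{p}(n)$ is the number of overpartitions of $n$, with $\overline{p}(0)=1$, so that $\sum_{n\ge0}\overline{p}(n)q^n=\prod_{n\ge1}\frac{1+q^n}{1-q^n}$. By convention $\overline{p}(x)=0$ if $x$ is not a nonnegative integer. Negative powers of $\ell$ denote inverses of $\ell$ modulo the respective modulus ($16$ or $2^\gamma$). $\left(\frac{\cdot}{\ell}\right)$ is the Legendre symbol (equal to $0$ when $\ell \mid n$). *)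

(* Defs.v *)
From mathcomp Require Import all_boot all_order all_algebra.

Set Implicit Arguments.
Unset Strict Implicit.
Unset Printing Implicit Defensive.

Import Order.TTheory GRing.Theory Num.Theory.

(* An overpartition is written as the weakly decreasing list of its parts, each
   part carrying a boolean that tells whether it is overlined. *)
Definition is_overpartition (n : nat) (s : seq (nat * bool)) : bool :=
  [&& sorted geq (unzip1 s),
      all (fun a => 0 < a) (unzip1 s),
      sumn (unzip1 s) == n &
      all (fun i => nth false (unzip2 s) i ==>
                    (nth 0 (unzip1 s) i \notin take i (unzip1 s)))
          (iota 0 (size s))].

(* An overpartition of n has at most n parts, all of them at most n, so the
   bounds in n.-bseq and 'I_n.+1 exclude nothing. *)
Definition overpartitions (n : nat) : {set n.-bseq ('I_n.+1 * bool)} :=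
  [set s : n.-bseq ('I_n.+1 * bool) |
    is_overpartition n [seq (nat_of_ord a.1, a.2) | a <- s]].

Definition pbar (n : nat) : nat := #|overpartitions n|.

Definition pbarq (x : rat) : nat :=
  if x \is a Num.nat then pbar (Num.truncn x) else 0.

Definition legendre (a : int) (p : nat) : int :=
  (if (p %| a)%Z then 0
   else if [exists x : 'I_p, (x%:Z ^+ 2 == a %[mod p])%Z] then 1
   else -1)%R.

(* The final 0 is only reached when l is even. *)
Definition gamma (l : nat) : nat :=
  if l %% 8 == 3 then 5
  else if (l %% 8 == 5) || (l %% 8 == 7) then 6
  else if l %% 8 == 1 then 7
  else 0.

(* Main.v *)
Require Import Defs.
From mathcomp Require Import all_boot all_order all_algebra all_field.
From mathcomp Require Import ring zify.

(* Let theta = sum_(x in Z) q^(x^2). By Gauss's identity the generating function of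
   (-1)^n pbar(n) is 1 / theta, and expanding it in powers of theta - 1 = 2 T expresses
   pbar(n) modulo 128 by the numbers of representations of n as sums of at most six
   positive squares. Since T^2 = T(q^2) modulo 2, the sums of four, five and six squares
   collapse to ternary ones: up to terms supported on n = m^2 and n = 2 m^2, both
   pbar(n) mod 16 and n pbar(n) mod 128 are combinations of r_3(n), n r_3(n) and r_3(2 n),
   where r_3 counts representations as sums of three squares.

   The Hecke relation r_3(l^2 n) + (-n / l) r_3(n) + l r_3(n / l^2) = (l + 1) r_3(n)
   holds exactly. For each of the l + 1 isotropic lines v of F_l^3 let M_v be l times the
   l-neighbour of Z^3 along v. Hermite reduction shows that M_v has an orthogonal basis of
   vectors of norm l^2, so it contains r_3(n) vectors of norm l^2 n. On the other hand a
   vector of norm l^2 n that is nonzero mod l lies in exactly one M_v, and l y lies in M_v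
   iff v is orthogonal to y mod l, which holds for 1 + (-n / l) lines unless y = 0 mod l.

   The defect of n r_3(n) is (l^2 - 1) times an expression determined mod 8 by the squares,
   and gamma is the exponent to which it cancels against the terms supported on n = m^2. *)

Set Implicit Arguments.
Unset Strict Implicit.
Unset Printing Implicit Defensive.

Import Order.TTheory GRing.Theory Num.Theory.

(** * Counting overpartitions *)

(** The neighbours can be counted because Z^3 is alone in its genus: in [M_v] all products are
    divisible by l^2 and the Gram determinant is l^6, the least value this allows, so the reduction
    bounds leave room for an orthogonal basis only. Defining [M_v] requires representatives of the
    isotropic lines whose norm is divisible by l^2; they all come from one lifted solution of a^2 +
    b^2 + 1 = 0.

    The dependence of gamma on l mod 8 has two sources away from squares. The factor 8 (l^2 - 1) is
    divisible by 128 when l = 1, 7 mod 8, but in general only by 64. For odd n the Hecke relation is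
    also used at 2 n, where the character is (2 / l) (-n / l); if (2 / l) = -1 the mismatch leaves 8
    (-n / l) r_3(2 n) / 3, which is controlled modulo 64 only. The terms at squares n then lower the
    exponent once more for l = 3 and l = 7 mod 8. *)

Definition opart_rel (a b : nat * bool) : bool :=
  (b.1 < a.1) || ((b.1 == a.1) && ~~ b.2).

Lemma opart_rel_trans : transitive opart_rel.
Proof.
move=> [y b] [x a] [z c]; rewrite /opart_rel /=.
case: (ltngtP y x) => //= [yx _|-> b0]; last by case: (ltngtP z x).
by case/orP => [zy|/andP[/eqP -> _]]; rewrite ?(ltn_trans zy yx) ?yx.
Qed.

Lemma opart_relE a b : opart_rel a b = (b.1 <= a.1) && (b.2 ==> (b.1 != a.1)).
Proof. by rewrite /opart_rel; case: ltngtP; case: b.2. Qed.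

(** That an overlined part has no earlier copy is a condition on pairs of entries, so together with
    the order of the parts it is sortedness for one transitive relation. *)
Lemma is_overpartitionE n s :
  is_overpartition n s =
  [&& sorted opart_rel s, all (fun a => 0 < a.1) s & sumn (unzip1 s) == n].
Proof.
rewrite /is_overpartition; set D := all _ (iota 0 _).
suff -> : sorted opart_rel s = sorted geq (unzip1 s) && D.
  by rewrite all_map andbAC -!andbA; do !bool_congr.
rewrite /D {D}.
have geq_trans : transitive geq by move=> y x z /= yx zy; apply: leq_trans yx.
rewrite (sorted_pairwise opart_rel_trans) (sorted_pairwise geq_trans).
elim: s => //= a s IHs.
set c := all _ (iota 1 _).
have -> : c = all (fun b => b.2 ==> (b.1 != a.1)) s &&
    all (fun i => nth false (unzip2 s) i ==> (nth 0 (unzip1 s) i \notin take i (unzip1 s)))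
      (iota 0 (size s)).
  rewrite /c -[1]addn0 iotaDl all_map -[X in all _ X && _](mkseq_nth (0, false)) /mkseq all_map.
  rewrite -[RHS]all_predI; apply: eq_in_all => i; rewrite mem_iota /= => hi.
  rewrite !(nth_map (0, false)) // inE negb_or.
  by case: (nth _ s i).2.
rewrite implybT andTb andbACA IHs; congr (_ && _).
rewrite all_map -[RHS]all_predI; apply: eq_all => b /=.
by rewrite opart_relE.
Qed.

(** What may follow an occurrence of [k]: more copies of [k], none overlined because they are not
    the first, and then an element of [base]. The [fuel] only serves termination. *)
Fixpoint oparts_rep (base : nat -> seq (seq (nat * bool))) (k fuel n : nat) :=
  base n ++ if fuel is fuel'.+1 then
    if k <= n then [seq (k, false) :: s | s <- oparts_rep base k fuel' (n - k)]
    else [::] else [::].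

Fixpoint oparts (k n : nat) : seq (seq (nat * bool)) :=
  if k is k'.+1 then
    oparts k' n ++
    if k <= n then [seq (k, true) :: s | s <- oparts_rep (oparts k') k n (n - k)] ++
                   [seq (k, false) :: s | s <- oparts_rep (oparts k') k n (n - k)]
    else [::]
  else if n == 0 then [:: [::]] else [::].

Definition bounded_opart (k n : nat) (s : seq (nat * bool)) :=
  [&& sorted opart_rel s, all (fun a => 0 < a.1 <= k) s & sumn (unzip1 s) == n].

(* The possible continuations of an overpartition whose last part so far is k. *)
Definition tail_opart (k n : nat) (s : seq (nat * bool)) :=
  [&& path opart_rel (k, true) s, all (fun a => 0 < a.1) s & sumn (unzip1 s) == n].

Lemma path_opart k b c s : path opart_rel (k, b) s = path opart_rel (k, c) s.
Proof. by case: s. Qed.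

Lemma path_opart_le k b s : path opart_rel (k, b) s -> all (fun a => a.1 <= k) s.
Proof.
move/(order_path_min opart_rel_trans); apply: sub_all => a.
by rewrite opart_relE => /andP[].
Qed.

Lemma bounded_opart_cons k n c s :
  bounded_opart k.+1 n (c :: s) = bounded_opart k n (c :: s) ||
     [&& c.1 == k.+1, k.+1 <= n & tail_opart k.+1 (n - k.+1) s].
Proof.
case: c => c b; rewrite /bounded_opart /tail_opart /=.
have [hp|] := boolP (path opart_rel (c, b) s); last first.
  by case: (c =P k.+1) => // -> hp; rewrite (path_opart _ true b) (negbTE hp) !andbF.
have hle := path_opart_le hp.
case: (ltngtP c k.+1) => [ck|ck|ck] /=.
- rewrite orbF ltnS in ck *; rewrite ck andbT; congr (_ && _); congr (_ && _).
  apply: eq_in_all => a /(allP hle) ac.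
  by rewrite (leq_trans ac ck) (leq_trans ac (leqW ck)).
- by rewrite [c <= k]leqNgt (ltnW ck) !andbF.
rewrite ck ltnn !andbF /= -ck in hp *.
rewrite (path_opart _ true b) hp /=.
have -> : all (fun a => 0 < a.1 <= c) s = all (fun a => 0 < a.1) s.
  by apply: eq_in_all => a /(allP hle) ->; rewrite andbT.
case: (leqP c n) => cn /=; last first.
  by apply/negbTE/nandP; right; rewrite neq_ltn (leq_trans cn) ?orbT // leq_addr.
by congr (_ && _); apply/eqP/eqP; lia.
Qed.

Lemma tail_opart_cons k n c s :
  tail_opart k.+1 n (c :: s) = bounded_opart k n (c :: s) ||
     [&& c == (k.+1, false), k.+1 <= n & tail_opart k.+1 (n - k.+1) s].
Proof.
have -> : tail_opart k.+1 n (c :: s) =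
    bounded_opart k.+1 n (c :: s) && (c.2 ==> (c.1 != k.+1)).
  rewrite /tail_opart /bounded_opart /= opart_relE /=.
  have [hp|hp] := boolP (path opart_rel c s); last by rewrite !andbF.
  case: c hp => c b /= hp; have hle := path_opart_le hp.
  case: (leqP c k.+1) => ck /=; last by rewrite !andbF.
  have -> : all (fun a => 0 < a.1 <= k.+1) s = all (fun a => 0 < a.1) s.
    by apply: eq_in_all => a /(allP hle) ac; rewrite (leq_trans ac ck) andbT.
  by case: (b ==> _); case: (0 < c); case: all; case: (_ == n).
rewrite bounded_opart_cons andb_orl; congr (_ || _).
  apply: andb_idr; rewrite /bounded_opart /= => /and3P[_ /andP[/andP[_ ck] _] _].
  by rewrite neq_ltn ltnS ck implybT.
case: c => c b /=; rewrite -[_ == (_, _)]/((c == k.+1) && (b == false)).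
by case: (c == k.+1); case: b; rewrite ?andbT ?andbF.
Qed.

Lemma mem_oparts_rep base k fuel n s : (forall m s, (s \in base m) = bounded_opart k m s) ->
  n <= fuel -> (s \in oparts_rep base k.+1 fuel n) = tail_opart k.+1 n s.
Proof.
move=> hb; elim: fuel n s => [|fuel IH] n s hn /=; rewrite mem_cat hb.
  rewrite in_nil orbF; case: s => // c s.
  by move: hn; rewrite tail_opart_cons leqn0 => /eqP ->; rewrite ltn0 andbF orbF.
case: s => [|c s].
  rewrite [X in _ || X](_ : _ = false) ?orbF //.
  by case: ifP => // _; apply/mapP => -[].
rewrite tail_opart_cons; congr (_ || _).
case: leqP => kn; first by rewrite /= andbF.
rewrite -IH; last by lia.
apply/mapP/andP => [[s' hs' [-> ->]]|[/eqP -> hs]]; first by rewrite eqxx.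
by exists s.
Qed.

Lemma mem_oparts k n s : (s \in oparts k n) = bounded_opart k n s.
Proof.
elim: k n s => [|k IH] n s /=.
  rewrite /bounded_opart; case: s => [|[[|c] b] s] /=; case: n => //=;
    by rewrite ?inE ?andbF.
rewrite mem_cat IH; case: s => [|c s].
  rewrite [X in _ || X](_ : _ = false) ?orbF //.
  by case: ifP => // _; rewrite mem_cat; apply/orP => -[] /mapP[].
rewrite bounded_opart_cons; congr (_ || _).
case: leqP => kn; first by rewrite /= andbF.
rewrite -(mem_oparts_rep _ (fuel := n) IH); last by lia.
rewrite mem_cat; apply/orP/andP => [[] /mapP[s' hs' [-> ->]] | [/eqP hc hs]] //.
by case: c hc => c [] /= ->; [left|right]; apply/mapP; exists s.
Qed.

Lemma oparts_rep_uniq base k fuel n : (forall m s, (s \in base m) = bounded_opart k m s) ->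
  (forall m, uniq (base m)) -> n <= fuel -> uniq (oparts_rep base k.+1 fuel n).
Proof.
move=> hb ub; elim: fuel n => [|fuel IH] n hn /=; first by rewrite cats0.
rewrite cat_uniq ub /=; case: ifP => //= kn.
rewrite map_inj_uniq ?IH ?andbT; [|by lia|by move=> u v []].
apply/hasPn => s /mapP[s' _ ->]; rewrite hb /bounded_opart /= ltnn.
by rewrite !andbF.
Qed.

Lemma oparts_uniq k n : uniq (oparts k n).
Proof.
elim: k n => [|k IH] n /=; first by case: (n == 0).
rewrite cat_uniq IH /=; case: ifP => //= kn; apply/andP; split.
  apply/hasPn => s; rewrite mem_cat => /orP[] /mapP[s' _ ->];
    by rewrite mem_oparts /bounded_opart /= ltnn !andbF.
have uw : uniq (oparts_rep (oparts k) k.+1 n (n - k.+1)).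
  by apply: oparts_rep_uniq => //; [exact: mem_oparts|lia].
rewrite cat_uniq !map_inj_uniq ?uw /= ?andbT; try by move=> u v [].
by apply/hasPn => s /mapP[s' _ ->]; apply/mapP => -[].
Qed.

Definition n_oparts k n := size (oparts k n).

Lemma size_oparts_rep base k fuel fuel' n : n <= fuel -> n <= fuel' ->
  size (oparts_rep base k.+1 fuel n) = size (oparts_rep base k.+1 fuel' n).
Proof.
elim: fuel fuel' n => [|fuel IH] [|fuel'] n //= hn hn'; rewrite !size_cat; case: leqP => //= kn.
all: try by lia.
by rewrite !size_map (IH fuel'); lia.
Qed.

(** Coefficient form of (1 - q^(k+1)) P_(k+1) = (1 + q^(k+1)) P_k. The number [w] of tails is
    eliminated between its recursion [wE] and [E], whose factor 2 is the choice of overlining the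
    first [k.+1]. *)
Lemma n_opartsS k n : n_oparts k.+1 n =
  n_oparts k n + (if k.+1 <= n then n_oparts k.+1 (n - k.+1) + n_oparts k (n - k.+1) else 0).
Proof.
pose w m := size (oparts_rep (oparts k) k.+1 m m).
have wE m : w m = n_oparts k m + (if k.+1 <= m then w (m - k.+1) else 0).
  rewrite /w /n_oparts; case: m => [|m] /=; first by rewrite size_cat addn0.
  rewrite size_cat; case: leqP => //= km; rewrite size_map.
  by congr (_ + _); apply: size_oparts_rep; lia.
have E m : n_oparts k.+1 m = n_oparts k m + (if k.+1 <= m then 2 * w (m - k.+1) else 0).
  rewrite /n_oparts /= size_cat; case: leqP => //= km.
  rewrite size_cat !size_map addnn -mul2n.
  by congr (_ + 2 * _); apply: size_oparts_rep; lia.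
rewrite E; case: leqP => // kn; congr (_ + _).
by rewrite wE E; case: ifP; lia.
Qed.

Lemma n_oparts0 n : n_oparts 0 n = (n == 0).
Proof. by rewrite /n_oparts /=; case: eqP. Qed.

Lemma pbar_n_oparts k n : n <= k -> pbar n = n_oparts k n.
Proof.
move=> nk.
pose f (s : n.-bseq ('I_n.+1 * bool)) := [seq (nat_of_ord a.1, a.2) | a <- s].
have finj : injective f.
  move=> s t /inj_map E; apply: val_inj; apply: E => -[i b] [j c] /= [ij ->].
  by rewrite (val_inj ij).
rewrite /pbar cardE -(size_map f); apply/perm_size/uniq_perm.
- by rewrite (map_inj_uniq finj) enum_uniq.
- exact: oparts_uniq.
move=> s; rewrite mem_oparts; apply/mapP/idP.
  case=> t; rewrite mem_enum inE is_overpartitionE -/(f t) => h ->.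
  rewrite /bounded_opart; case/and3P: h => -> hp -> /=; rewrite andbT.
  apply/allP => a ha; rewrite (allP hp _ ha) /=.
  by case/mapP: ha => -[i b] _ ->; apply: leq_trans nk; rewrite -ltnS ltn_ord.
case/and3P => srt pos /eqP sum.
have le a : a \in s -> a.1 <= n.
  move=> ha; rewrite -sum; have : a.1 \in unzip1 s by apply: map_f.
  elim: (unzip1 s) => //= b u IH; rewrite inE => /orP[/eqP ->|/IH]; first exact: leq_addr.
  by move=> h; apply: leq_trans h (leq_addl _ _).
have sz : size s <= n.
  rewrite -sum; elim: s pos {srt sum le} => //= a s IH /andP[/andP[a0 _] /IH h].
  by rewrite -add1n leq_add.
pose t : seq ('I_n.+1 * bool) := [seq (inord a.1, a.2) | a <- s].
have st : size t <= n by rewrite size_map.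
have ft : f (Bseq st) = s.
  rewrite /f /= -map_comp -[RHS]map_id; apply/eq_in_map => a /le an /=.
  by rewrite inordK //; case: a an.
exists (Bseq st); last by rewrite ft.
rewrite mem_enum inE is_overpartitionE -/(f _) ft srt sum eqxx andbT /=.
by apply: sub_all pos => a /andP[].
Qed.

Local Open Scope ring_scope.

(** * Gauss's identity *)

(** Equality modulo ['X^(N.+1)]: polynomials stand in for power series and infinite products. *)
Definition eq_upto (N : nat) (p q : {poly int}) :=
  forall i, (i <= N)%N -> p`_i = q`_i.

Lemma eq_upto_refl N p : eq_upto N p p. Proof. by []. Qed.

Lemma eq_upto_trans N p q r : eq_upto N p q -> eq_upto N q r -> eq_upto N p r.
Proof. by move=> h g i iN; rewrite h // g. Qed.

Lemma eq_uptoM N p q p' q' :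
  eq_upto N p q -> eq_upto N p' q' -> eq_upto N (p * p') (q * q').
Proof.
move=> h h' i iN; rewrite !coefM; apply: eq_bigr => j _.
by rewrite h ?h' //; have := ltn_ord j; lia.
Qed.

(** A constant term 1 makes [d] invertible as a power series; the coefficients are compared by
    strong induction. *)
Lemma eq_upto_cancel N (d p q : {poly int}) :
  d`_0 = 1 -> eq_upto N (d * p) (d * q) -> eq_upto N p q.
Proof.
move=> d0 h i; elim/ltn_ind: i => i IH iN.
have := h i iN; rewrite !coefM !big_ord_recl /= !subn0 d0 !mul1r.
rewrite (eq_bigr (fun j : 'I_i => d`_(lift ord0 j) * q`_(i - lift ord0 j))).
  by apply: addIr.
by move=> j _; rewrite IH //=; have := ltn_ord j; rewrite /bump /=; lia.
Qed.

Section Gauss.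

Let U (n s : nat) : {poly int} :=
  (\prod_(s <= i < n) (1 - 'X^(i.+1) : {poly int})) *
  (\prod_(0 <= i < s) (1 + 'X^i : {poly int})) * 'X^(s * n.+1).

(** Telescoping certificate: by [U_step] it also equals [U n s.+1 * (1 - 'X^(s.+1))], so consecutive
    terms of the alternating sum cancel. *)
Let E n s : {poly int} := U n s * 'X^(n.+1) * (1 + 'X^s).

Let U_diag n : U n n = (\prod_(0 <= i < n) (1 + 'X^i : {poly int})) * 'X^(n * n.+1).
Proof. by rewrite /U big_geq // mul1r. Qed.

Let U_step n s : (s < n)%N -> U n s.+1 * (1 - 'X^(s.+1)) = E n s.
Proof.
move=> sn; rewrite /E /U (big_nat_recr s) //= [in RHS](big_ltn sn) mulSn exprD.
by ring.
Qed.

Let U_telescope n m : (m <= n)%N ->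
  \sum_(0 <= s < m.+1) (-1) ^+ s * (U n s * (1 - 'X^s) + E n s) = (-1) ^+ m * E n m.
Proof.
elim: m => [|m IH] mn; first by rewrite big_nat1 expr0 subrr mulr0 add0r.
by rewrite big_nat_recr //= IH 1?ltnW // U_step // exprS; ring.
Qed.

Definition theta_alt n : {poly int} :=
  1 + 2 * \sum_(0 <= m < n) (-1) ^+ m.+1 * 'X^(m.+1 ^ 2).

(* A finite form of Gauss's identity, after Shanks. *)
Lemma gauss_finite n :
  (\prod_(0 <= i < n) (1 + 'X^(i.+1) : {poly int})) * theta_alt n =
  \sum_(0 <= s < n.+1) (-1) ^+ s * U n s.
Proof.
elim: n => [|n IH].
  rewrite [RHS]big_nat1 U_diag /theta_alt !big_geq // mul0n expr0; ring.
have th : theta_alt n.+1 = theta_alt n + 2 * ((-1) ^+ n.+1 * 'X^(n.+1 ^ 2)).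
  by rewrite /theta_alt big_nat_recr //=; ring.
rewrite th mulrDr big_nat_recr //= mulrAC IH [RHS]big_nat_recr //=.
have -> : \sum_(0 <= s < n.+1) (-1) ^+ s * U n.+1 s =
   (1 + 'X^(n.+1)) * (\sum_(0 <= s < n.+1) (-1) ^+ s * U n s)
   - \sum_(0 <= s < n.+1) (-1) ^+ s * (U n s * (1 - 'X^s) + E n s).
  rewrite mulr_sumr -sumrB; apply: eq_big_nat => s /andP[_ sn].
  have -> : U n.+1 s = U n s * (1 - 'X^(n.+1)) * 'X^s.
    by rewrite /U (big_nat_recr n) //= mulnS addnC exprD; ring.
  by rewrite /E; ring.
rewrite U_telescope // /E !U_diag.
(* The factor at [i = 0] is 2, and it produces the 2 in [theta_alt]. *)
have hQ : \prod_(0 <= i < n.+1) (1 + 'X^i : {poly int}) =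
    2 * \prod_(0 <= i < n) (1 + 'X^(i.+1) : {poly int}).
  by rewrite big_nat_recl //= expr0.
have e := hQ; rewrite big_nat_recr //= in e; rewrite hQ.
have -> : (n.+1 ^ 2 = n * n.+1 + n.+1)%N by lia.
have -> : (n.+1 * n.+2 = n * n.+1 + n.+1 + n.+1)%N by lia.
rewrite !exprD !exprS.
move: e; move: (\prod_(_ <= _ < _) _) (\prod_(_ <= _ < _) _) => P Q e.
have -> : Q * 'X^(n * n.+1) * ('X * 'X^n) * (1 + 'X^n) =
    Q * (1 + 'X^n) * 'X^(n * n.+1) * ('X * 'X^n) by ring.
by rewrite e; ring.
Qed.

(** In [gauss_finite] the summand [U n s] is divisible by ['X^(s * n.+1)], so up to degree [n] only
    [s = 0] survives. *)
Lemma gauss_upto n :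
  eq_upto n ((\prod_(0 <= i < n) (1 + 'X^(i.+1) : {poly int})) * theta_alt n)
    (\prod_(0 <= i < n) (1 - 'X^(i.+1))).
Proof.
rewrite gauss_finite big_nat_recl // expr0 mul1r => i iN.
rewrite coefD [X in _ + X](_ : _ = 0) ?addr0.
  by rewrite /U [X in _ * X * _]big_geq // mul0n expr0 !mulr1.
rewrite coef_sum big1 // => s _.
have -> : (-1) ^+ s.+1 * U n s.+1 = 'X^(n.+1) * ((-1) ^+ s.+1 *
    ((\prod_(s.+1 <= i < n) (1 - 'X^(i.+1) : {poly int})) *
     (\prod_(0 <= i < s.+1) (1 + 'X^i : {poly int})) * 'X^(s * n.+1))).
  by rewrite /U mulSn exprD; ring.
by rewrite coefXnM ltnS iN.
Qed.

End Gauss.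

(** * Generating polynomials of overpartitions *)

Definition opart_poly N k : {poly int} := \poly_(i < N.+1) (n_oparts k i)%:R.

Lemma opart_poly_step N k :
  eq_upto N ((1 - 'X^(k.+1)) * opart_poly N k.+1) ((1 + 'X^(k.+1)) * opart_poly N k).
Proof.
move=> i iN; rewrite mulrBl mulrDl !mul1r coefB coefD !coefXnM !coef_poly ltnS iN.
rewrite (leq_ltn_trans (leq_subr _ _)) // n_opartsS.
by case: (leqP k.+1 i) => ik; rewrite ?addn0 ?subr0 ?addr0 ?natrD; ring.
Qed.

Lemma opart_poly_prod N k :
  eq_upto N ((\prod_(0 <= i < k) (1 - 'X^(i.+1) : {poly int})) * opart_poly N k)
    (\prod_(0 <= i < k) (1 + 'X^(i.+1))).
Proof.
elim: k => [|k IH].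
  rewrite !big_geq // mul1r => i iN; rewrite coef_poly ltnS iN n_oparts0 coef1.
  by case: eqP.
rewrite !big_nat_recr //= -mulrA.
apply: (eq_upto_trans (eq_uptoM (@eq_upto_refl N _) (@opart_poly_step N k))).
by rewrite mulrCA mulrC; apply: (eq_uptoM IH).
Qed.

Definition square_poly N : {poly int} := \sum_(0 <= m < N) 'X^(m.+1 ^ 2).

Definition signed_pbar_poly N : {poly int} := \poly_(i < N.+1) ((-1) ^+ i * (pbar i)%:R).

(** Gauss's identity with q replaced by -q: [m ^ 2] has the parity of [m], so the signs of
    [theta_alt] disappear and pass to [pbar]. *)
Lemma theta_signed_pbar N :
  eq_upto N ((1 + 2 * square_poly N) * signed_pbar_poly N) 1.
Proof.
have h : eq_upto N (theta_alt N * opart_poly N N) 1.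
  apply: (@eq_upto_cancel _ (\prod_(0 <= i < N) (1 - 'X^(i.+1)))).
    rewrite -horner_coef0 horner_prod big1 // => i _.
    by rewrite hornerD hornerN hornerXn hornerC expr0n subr0.
  rewrite mulr1 mulrCA; rewrite mulrC.
  apply: (eq_upto_trans _ (@gauss_upto N)).
  exact: (eq_uptoM (@opart_poly_prod N N) (@eq_upto_refl N _)).
move=> i iN; transitivity ((-1) ^+ i * (theta_alt N * opart_poly N N)`_i); last first.
  by rewrite h // coef1; case: i {iN} => [|i]; rewrite ?mulr1 ?mulr0.
rewrite !coefM [RHS]mulr_sumr; apply: eq_bigr => j _.
rewrite !coef_poly ltnS (leq_trans (leq_subr _ _) iN) (@pbar_n_oparts N); last first.
  exact: leq_trans (leq_subr _ _) iN.
have -> : (1 + 2 * square_poly N)`_j = (-1) ^+ j * (theta_alt N)`_j.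
  rewrite /theta_alt !coefD mulrDr !coef1 -!polyC_natr ![_%:P * _]mulrC !coefMC mulrA.
  congr (_ + _ * _); first by case: (nat_of_ord j) => [|k] /=; rewrite ?expr0 ?mul1r ?mulr0.
  rewrite /square_poly !coef_sum mulr_sumr; apply: eq_bigr => m _.
  rewrite -(rmorph_sign polyC) coefCM coefXn; case: eqP => [->|_]; last by rewrite !mulr0.
  by rewrite mulr1 -exprD -signr_odd oddD oddX addbb.
have -> : (-1) ^+ i = (-1) ^+ (i - j) * (-1) ^+ j :> int.
  by rewrite -exprD subnK // -ltnS.
by ring.
Qed.

(** * Reduction of ternary lattices *)

Definition vec := (int * int * int)%type.

Definition dot (u v : vec) : int := u.1.1 * v.1.1 + u.1.2 * v.1.2 + u.2 * v.2.

Definition lcomb (k : int) (u v : vec) : vec :=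
  (u.1.1 + k * v.1.1, u.1.2 + k * v.1.2, u.2 + k * v.2).

Definition det3 (u v w : vec) : int :=
  u.1.1 * (v.1.2 * w.2 - v.2 * w.1.2)
  - u.1.2 * (v.1.1 * w.2 - v.2 * w.1.1)
  + u.2 * (v.1.1 * w.1.2 - v.1.2 * w.1.1).

(** The product of the projections of [x] and [y] orthogonal to [e], scaled by [dot e e] to stay
    integral. *)
Definition pdot (e x y : vec) : int := dot e e * dot x y - dot x e * dot y e.

Ltac vsimp := rewrite /pdot /det3 /lcomb /dot /=.

Lemma dotC u v : dot u v = dot v u.
Proof. by vsimp; ring. Qed.

Lemma round_div (a m : int) : 0 < m -> exists k : int, 2 * `|a + k * m| <= m.
Proof.
move=> m0; exists (- ((2 * a + m) %/ (2 * m))%Z).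
have := divz_eq (2 * a + m) (2 * m).
have := modz_ge0 (2 * a + m) (_ : 2 * m != 0).
have := ltz_pmod (2 * a + m) (_ : 0 < 2 * m).
set q := (_ %/ _)%Z; set r := (_ %% _)%Z => /(_ ltac:(lia)) h1 /(_ ltac:(lia)) h2 h3.
have : 2 * (a + - q * m) = r - m by lia.
by lia.
Qed.

(** The classical bound for a reduced binary form [p x^2 + 2 r x y + q y^2]. It is applied both to
    the plane of [u] and [v] and to the form projected along [u]. *)
Lemma sqr_reduced (p q r : int) :
  0 < p -> 2 * `|r| <= p -> p <= q -> 3 * p ^+ 2 <= 4 * (p * q - r ^+ 2).
Proof.
move=> p0 rp pq.
have h1 : p * p <= p * q by rewrite ler_pM2l.
have : (2 * `|r|) ^+ 2 <= p ^+ 2 by rewrite ler_pXn2r // nnegrE ?ltW //; lia.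
by rewrite exprMn real_normK ?num_real // !expr2; lia.
Qed.

Lemma dot_ge0 u : 0 <= dot u u.
Proof. by vsimp; nia. Qed.

Section Reduction.

Variables (d : int) (M : vec -> Prop).
Hypothesis d_gt0 : 0 < d.
Hypothesis M_lcomb : forall k x y, M x -> M y -> M (lcomb k x y).
Hypothesis M_dot : forall x y, M x -> M y -> (d %| dot x y)%Z.

(** The square of [det3] is the Gram determinant, which [M_dot] makes a multiple of [d ^+ 3]; a
    triple attaining the least nonzero value is a basis of the lattice [M]. *)
Definition Mtriple u v w := [/\ M u, M v, M w & det3 u v w ^+ 2 = d ^+ 3].

Lemma Mtriple_pos u v w : Mtriple u v w -> 0 < dot u u.
Proof.
case=> _ _ _ hd.
case: (ltgtP 0 (dot u u)) => //; first by have := dot_ge0 u; lia.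
case: u hd => [[a b] c]; vsimp => + h.
have ha : a = 0 by nia.
have hb : b = 0 by nia.
have hc : c = 0 by nia.
rewrite ha hb hc !mul0r subr0 addr0 expr0n /= => h3.
by have := exprn_gt0 3 d_gt0; rewrite -h3.
Qed.

Lemma pdot_gram u v w :
  pdot u v v * pdot u w w - pdot u v w ^+ 2 = dot u u * det3 u v w ^+ 2.
Proof. by vsimp; ring. Qed.

Lemma Mtriple_pdot_pos u v w : Mtriple u v w -> 0 < pdot u v v.
Proof.
move=> t; have u0 := Mtriple_pos t.
have := pdot_gram u v w; case: t => _ _ _ ->.
have := exprn_gt0 3 d_gt0 => d3.
have : 0 <= pdot u v v.
  (* Lagrange's identity: [pdot u v v] is the squared length of the cross product of [u] and [v]. *)
  rewrite (_ : pdot u v v = (u.1.2 * v.2 - u.2 * v.1.2) ^+ 2 +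
     (u.2 * v.1.1 - u.1.1 * v.2) ^+ 2 + (u.1.1 * v.1.2 - u.1.2 * v.1.1) ^+ 2).
    by rewrite !addr_ge0 ?sqr_ge0.
  by vsimp; ring.
have : 0 <= pdot u v w ^+ 2 by apply: sqr_ge0.
set p := pdot u v v; set q := _ ^+ 2; set r := pdot u w w.
have : 0 < dot u u * d ^+ 3 by apply: mulr_gt0.
set s := _ * _ => s0 q0 p0 E.
case: (ltgtP 0 p) => // [|pE]; first by lia.
by move: E; rewrite -pE mul0r; lia.
Qed.

(** Lexicographic descent on [dot u u] and [pdot u v v]. Shortening [v] modulo [u] leaves
    [pdot u v v] unchanged, and then [w] is shortened modulo [v] in projection; whenever a
    comparison fails, a swap lowers the measure. *)
Lemma Mtriple_reduced : (exists u v w, Mtriple u v w) ->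
  exists u v w, [/\ Mtriple u v w,
    2 * `|dot v u| <= dot u u, dot u u <= dot v v,
    2 * `|pdot u w v| <= pdot u v v & pdot u v v <= pdot u w w].
Proof.
case=> [u [v [w]]].
have [n] := ubnP `|dot u u|%N.
elim: n u v w => // n IHn u v w.
have [m] := ubnP `|pdot u v v|%N.
elim: m v w => // m IHm v w hm hn t.
have u0 := Mtriple_pos t.
have [k hk] := round_div (dot v u) u0.
pose v' := lcomb k v u.
have t' : Mtriple u v' w.
  case: t => Mu Mv Mw h; split=> //; first exact: M_lcomb.
  by rewrite -h; congr (_ ^+ 2); rewrite /v'; vsimp; ring.
have dv' : 2 * `|dot v' u| <= dot u u.
  suff -> : dot v' u = dot v u + k * dot u u by [].
  by rewrite /v'; vsimp; ring.
have pv' : pdot u v' v' = pdot u v v by rewrite /v'; vsimp; ring.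
case: (lerP (dot u u) (dot v' v')) => [le1|lt1]; last first.
  apply: (IHn v' u w).
    by move: (dot_ge0 v') lt1 hn; move: (dot v' v') (dot u u) => p q; lia.
  case: t' => Mu Mv Mw h; split=> //.
  by rewrite -h; vsimp; ring.
have p0 := Mtriple_pdot_pos t'.
have [k2 hk2] := round_div (pdot u w v') p0.
pose w' := lcomb k2 w v'.
have t2 : Mtriple u v' w'.
  case: t' => Mu Mv Mw h; split=> //; first exact: M_lcomb.
  by rewrite -h; congr (_ ^+ 2); rewrite /w'; vsimp; ring.
have pw' : 2 * `|pdot u w' v'| <= pdot u v' v'.
  suff -> : pdot u w' v' = pdot u w v' + k2 * pdot u v' v' by [].
  by rewrite /w'; vsimp; ring.
case: (lerP (pdot u v' v') (pdot u w' w')) => [le2|lt2].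
  by exists u, v', w'.
have t3 : Mtriple u w' v'.
  case: t2 => Mu Mv Mw h; split=> //.
  by rewrite -h; vsimp; ring.
apply: (IHm w' v') => //.
by move: (Mtriple_pdot_pos t3) lt2 hm; rewrite pv'; move: (pdot u v v) (pdot u w' w') => p q; lia.
Qed.

Lemma dvd_small x : (d %| x)%Z -> 2 * `|x| <= d -> x = 0.
Proof.
case/dvdzP=> k ->; rewrite normrM (ger0_norm (ltW d_gt0)) => h.
have -> : k = 0 by nia.
by rewrite mul0r.
Qed.

(** The two binary bounds combine to [27 (dot u u)^3 <= 64 d^3]. As [d] divides [dot u u], only
    [dot u u = d] is left; each reduced product is then a multiple of [d] of size at most [d / 2],
    hence 0. *)
Lemma orthogonal_basis : (exists u v w, Mtriple u v w) ->
  exists u v w, [/\ M u, M v & M w] /\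
   [/\ dot u u = d, dot v v = d & dot w w = d] /\
   [/\ dot u v = 0, dot u w = 0 & dot v w = 0].
Proof.
case/Mtriple_reduced=> u [v [w [t h1 h2 h3 h4]]].
have u0 := Mtriple_pos t; have p0 := Mtriple_pdot_pos t.
have [Mu Mv Mw hd] := t.
have gram := pdot_gram u v w; rewrite hd in gram.
have key : 3 * pdot u v v ^+ 2 <= 4 * (dot u u * d ^+ 3).
  rewrite -gram (_ : pdot u v w = pdot u w v); last by vsimp; ring.
  exact: sqr_reduced.
have pvv : pdot u v v = dot u u * dot v v - dot v u ^+ 2 by vsimp; ring.
have p34 : 3 * dot u u ^+ 2 <= 4 * pdot u v v.
  by rewrite pvv; apply: sqr_reduced.
have uu : dot u u = d.
  have /dvdzP[k hk] := (M_dot Mu Mu).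
  move: u0 p34 key p0; rewrite hk; move: (pdot u v v) => p k0 p34 key p0.
  have k1 : 1 <= k by nia.
  have kd0 : 0 < k * d by apply: mulr_gt0; lia.
  have le27 : 27 * (k * d) ^+ 3 <= 64 * d ^+ 3.
    have le9 : (3 * (k * d) ^+ 2) ^+ 2 <= (4 * p) ^+ 2.
      by rewrite ler_pXn2r // nnegrE mulr_ge0 ?sqr_ge0 ?ltW.
    rewrite -(ler_pM2l kd0).
    have -> : k * d * (27 * (k * d) ^+ 3) = 3 * (3 * (k * d) ^+ 2) ^+ 2 by ring.
    have -> : k * d * (64 * d ^+ 3) = 16 * (4 * (k * d * d ^+ 3)) by ring.
    move: le9 key; rewrite [(4 * p) ^+ 2]exprMn (_ : 4 ^+ 2 = 16) //.
    move: (p ^+ 2) (k * d * d ^+ 3) (_ ^+ 2); lia.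
  have : 27 * k ^+ 3 <= 64.
    rewrite -(ler_pM2r (exprn_gt0 3 d_gt0)) -mulrA -exprMn; exact: le27.
  case: (ltP 1 k) => [k2|k2] hle; last by have -> : k = 1; [lia|rewrite mul1r].
  have : 2 ^+ 3 <= k ^+ 3 by rewrite ler_pXn2r // nnegrE; lia.
  by rewrite (_ : 2 ^+ 3 = 8) //; lia.
have vu : dot v u = 0 by apply: dvd_small; [exact: M_dot | rewrite -uu].
have vv : dot v v = d.
  have /dvdzP[k hk] := (M_dot Mv Mv).
  move: key h2; rewrite pvv vu uu hk expr0n subr0 => key h2.
  have k1 : 1 <= k by rewrite -(ler_pM2r d_gt0) mul1r.
  have : 3 * k ^+ 2 * d ^+ 4 <= 4 * d ^+ 4.
    by rewrite !expr2 !exprS expr0 in key *; lia.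
  rewrite ler_pM2r ?exprn_gt0 // expr2 => h.
  have -> : k = 1 by move: h k1; clear; nia.
  by rewrite mul1r.
have wv : dot w v = 0.
  apply: dvd_small; first exact: M_dot.
  have : pdot u w v = d * dot w v by rewrite /pdot uu vu mulr0 subr0.
  move: h3 => /[swap] ->; rewrite pvv uu vv vu expr0n subr0 normrM.
  by rewrite (ger0_norm (ltW d_gt0)) mulrCA ler_pM2l.
(* The reduction has not touched [w] modulo [u]; now that [dot u u = d] divides [dot w u],
   subtracting a multiple of [u] makes them exactly orthogonal. *)
have /dvdzP[k hk] := (M_dot Mw Mu).
pose w' := lcomb (- k) w u.
have w'u : dot w' u = 0.
  have -> : dot w' u = dot w u - k * dot u u by rewrite /w'; vsimp; ring.
  by rewrite hk uu subrr.
have w'v : dot w' v = 0.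
  have -> : dot w' v = dot w v - k * dot v u by rewrite /w'; vsimp; ring.
  by rewrite wv vu mulr0 subrr.
exists u, v, w'; split; first by split=> //; apply: M_lcomb.
split; last by split; rewrite 1?dotC.
split=> //.
have : det3 u v w' ^+ 2 = dot u u * dot v v * dot w' w' - dot u u * dot w' v ^+ 2
   - dot v v * dot w' u ^+ 2 - dot w' w' * dot v u ^+ 2 +
   2 * dot v u * dot w' u * dot w' v by vsimp; ring.
have -> : det3 u v w' = det3 u v w by rewrite /w'; vsimp; ring.
rewrite hd w'u w'v vu uu vv => E.
apply: (mulfI (_ : d * d != 0)); first by rewrite mulf_neq0 // gt_eqF.
by rewrite !exprS expr0 in E *; lia.
Qed.

End Reduction.

(** * Neighbours of the cubic lattice *)

Lemma dvdz_lin1 (m f a e : int) : (m %| a)%Z -> e = f * a -> (m %| e)%Z.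
Proof. by move=> ma ->; rewrite dvdz_mull. Qed.

Lemma dvdz_lin2 (m f a g b e : int) :
  (m %| a)%Z -> (m %| b)%Z -> e = f * a + g * b -> (m %| e)%Z.
Proof. by move=> ma mb ->; rewrite rpredD ?dvdz_mull. Qed.

Lemma dvdz_lin3 (m f a g b h c e : int) :
  (m %| a)%Z -> (m %| b)%Z -> (m %| c)%Z -> e = f * a + g * b + h * c -> (m %| e)%Z.
Proof. by move=> ma mb mc ->; rewrite !rpredD ?dvdz_mull. Qed.

Lemma unit_inv (m x : int) : coprimez m x -> exists u : int, (m %| u * x - 1)%Z.
Proof.
case/coprimezP=> -[a b] /= h; exists b.
by apply: (dvdz_lin1 (f := - a) (dvdzz m)); lia.
Qed.

Definition vec0mod (l : nat) (v : vec) : bool :=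
  [&& (l %| v.1.1)%Z, (l %| v.1.2)%Z & (l %| v.2)%Z].

(* Membership in l L', where L' is the l-neighbour of Z^3 along the isotropic line of v. *)
Definition nbhd (l : nat) (v x : vec) : bool :=
  [&& (l %| x.1.1 * v.1.2 - x.1.2 * v.1.1)%Z,
      (l %| x.1.2 * v.2 - x.2 * v.1.2)%Z,
      (l %| x.2 * v.1.1 - x.1.1 * v.2)%Z
    & ((l%:Z ^+ 2)%R %| dot x v)%Z].

Section Neighbour.

Variable l : nat.
Hypothesis l_prime : prime l.

Lemma coprimez_prime (x : int) : coprimez l x = ~~ (l %| x)%Z.
Proof. by rewrite coprimezE prime_coprime. Qed.

Lemma Euclid_dvdz (x y : int) : (l %| x * y)%Z = (l %| x)%Z || (l %| y)%Z.
Proof. by rewrite !dvdzE abszM Euclid_dvdM. Qed.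

Lemma nbhd_lcomb v k x y : nbhd l v x -> nbhd l v y -> nbhd l v (lcomb k x y).
Proof.
case/and4P=> h1 h2 h3 h4 /and4P[g1 g2 g3 g4]; apply/and4P; split.
- by apply: (dvdz_lin2 (f := 1) (g := k) h1 g1); vsimp; ring.
- by apply: (dvdz_lin2 (f := 1) (g := k) h2 g2); vsimp; ring.
- by apply: (dvdz_lin2 (f := 1) (g := k) h3 g3); vsimp; ring.
- by apply: (dvdz_lin2 (f := 1) (g := k) h4 g4); vsimp; ring.
Qed.

Lemma dvdz_sqr_mul (x y : int) : (l %| x)%Z -> (l %| y)%Z ->
  ((l%:Z ^+ 2)%R %| x * y)%Z.
Proof. by move=> hx hy; rewrite expr2 dvdz_mul. Qed.

(** For a coordinate [z] of [v] prime to [l], the vectors [z x - xi v] and [z y - yi v] vanish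
    modulo [l], so their product [s] is divisible by l^2. Expanding it leaves [z ^+ 2 * dot x y] and
    multiples of [dot x v], [dot y v], [dot v v]. *)
Lemma nbhd_dot v x y : ((l%:Z ^+ 2)%R %| dot v v)%Z -> ~~ vec0mod l v ->
  nbhd l v x -> nbhd l v y -> ((l%:Z ^+ 2)%R %| dot x y)%Z.
Proof.
move=> hv nv /and4P[h1 h2 h3 h4] /and4P[g1 g2 g3 g4].
have fin (z : int) : ~~ (l %| z)%Z ->
    ((l%:Z ^+ 2)%R %| z ^+ 2 * dot x y)%Z -> ((l%:Z ^+ 2)%R %| dot x y)%Z.
  move=> hz; rewrite Gauss_dvdzr // coprimez_pexpl // coprimez_pexpr //.
  by rewrite coprimez_prime.
have gen (z xi yi s : int) : (l%:Z ^+ 2 %| s)%Z ->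
    z ^+ 2 * dot x y = xi * z * dot y v + yi * z * dot x v - xi * yi * dot v v + s ->
    ((l%:Z ^+ 2)%R %| z ^+ 2 * dot x y)%Z.
  move=> hs ->; rewrite rpredD // rpredB ?dvdz_mull //.
  by rewrite rpredD ?dvdz_mull.
case: (boolP (l %| v.1.1)%Z) => u1; last first.
  apply: (fin _ u1); apply: (gen _ x.1.1 y.1.1 _
    (rpredD (dvdz_sqr_mul h1 g1) (dvdz_sqr_mul h3 g3))).
  by vsimp; ring.
case: (boolP (l %| v.1.2)%Z) => u2; last first.
  apply: (fin _ u2); apply: (gen _ x.1.2 y.1.2 _
    (rpredD (dvdz_sqr_mul h1 g1) (dvdz_sqr_mul h2 g2))).
  by vsimp; ring.
case: (boolP (l %| v.2)%Z) => u3; last first.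
  apply: (fin _ u3); apply: (gen _ x.2 y.2 _
    (rpredD (dvdz_sqr_mul h2 g2) (dvdz_sqr_mul h3 g3))).
  by vsimp; ring.
by rewrite /vec0mod u1 u2 u3 in nv.
Qed.

(** A triangular basis: a multiple of [v] with one coordinate normalised to 1, [l] times a vector
    orthogonal to [v] modulo [l], and l^2 times a unit vector, of determinant l^3 up to sign. It
    needs two coordinates of [v] prime to [l]; with a single one, isotropy would make its square
    divisible by [l]. The three cases differ by a rotation of the coordinates. *)
Lemma nbhd_triple v : ((l%:Z ^+ 2)%R %| dot v v)%Z -> ~~ vec0mod l v ->
  exists x y z, Mtriple (l%:Z ^+ 2) (nbhd l v) x y z.
Proof.
have aux (p q r : int) : ~~ (l %| p)%Z -> ~~ (l %| q)%Z -> exists u c : int,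
    (l%:Z ^+ 2 %| u * p - 1)%Z /\ (l %| r + c * q)%Z.
  move=> hp hq.
  have [|u hu] := @unit_inv (l%:Z ^+ 2) p.
    by rewrite coprimez_pexpl // coprimez_prime.
  have [|w hw] := @unit_inv l q; first by rewrite coprimez_prime.
  exists u, (- r * w); split=> //.
  by apply: (dvdz_lin1 (f := - r) hw); ring.
have l1 (x : int) : (l%:Z ^+ 2 %| x)%Z -> (l %| x)%Z.
  by apply: dvdz_trans; rewrite expr2 dvdz_mulr.
have ll x y : (l %| x)%Z -> y = l%:Z * x -> (l%:Z ^+ 2 %| y)%Z.
  by move=> h ->; apply: dvdz_sqr_mul.
have l0 x y : y = l%:Z * x -> (l %| y)%Z by move=> ->; apply: dvdz_mulr.
have l2 x y : y = l%:Z ^+ 2 * x -> (l %| y)%Z.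
  by move=> ->; apply: l1; apply: dvdz_mulr.
have l3 x y : y = l%:Z ^+ 2 * x -> (l%:Z ^+ 2 %| y)%Z.
  by move=> ->; apply: dvdz_mulr.
case: v => [[v1 v2] v3]; rewrite /vec0mod /= => hv nv.
have hv' : (l %| v1 * v1 + v2 * v2 + v3 * v3)%Z by apply: l1.
have two : [|| ~~ (l %| v3)%Z && ~~ (l %| v2)%Z, ~~ (l %| v1)%Z && ~~ (l %| v3)%Z |
               ~~ (l %| v2)%Z && ~~ (l %| v1)%Z].
  move: nv; case: (boolP (l %| v1)%Z) => h1; case: (boolP (l %| v2)%Z) => h2;
    case: (boolP (l %| v3)%Z) => h3 //= _; exfalso.
  - suff : (l %| v3 * v3)%Z by rewrite Euclid_dvdz orbb; apply/negP.
    by apply: (dvdz_lin3 (f := 1) (g := - v1) (h := - v2) hv' h1 h2); ring.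
  - suff : (l %| v2 * v2)%Z by rewrite Euclid_dvdz orbb; apply/negP.
    by apply: (dvdz_lin3 (f := 1) (g := - v1) (h := - v3) hv' h1 h3); ring.
  - suff : (l %| v1 * v1)%Z by rewrite Euclid_dvdz orbb; apply/negP.
    by apply: (dvdz_lin3 (f := 1) (g := - v2) (h := - v3) hv' h2 h3); ring.
case/or3P: two => /andP[].
- move=> hp hq; have [u [c [hu hc]]] := aux _ _ v1 hp hq.
  exists (u * v1, u * v2, 1), (l%:Z, l%:Z * c, 0), (0, l%:Z ^+ 2, 0).
  split; last by vsimp; ring.
  + apply/and4P; split; vsimp.
    * by apply: (dvdz_lin1 (f := 0) (l1 _ hu)); ring.
    * by apply: (dvdz_lin1 (f := v2) (l1 _ hu)); ring.
    * by apply: (dvdz_lin1 (f := - v1) (l1 _ hu)); ring.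
    * by apply: (dvdz_lin2 (f := u) (g := - v3) hv hu); vsimp; ring.
  + apply/and4P; split; vsimp.
    * by apply: (l0 (v2 - c * v1)); ring.
    * by apply: (l0 (c * v3)); ring.
    * by apply: (l0 (- v3)); ring.
    * by apply: (ll _ _ hc); ring.
  + apply/and4P; split; vsimp.
    * by apply: (l2 (- v1)); ring.
    * by apply: (l2 v3); ring.
    * by apply: (l2 0); ring.
    * by apply: (l3 v2); ring.
- move=> hp hq; have [u [c [hu hc]]] := aux _ _ v2 hp hq.
  exists (1, u * v2, u * v3), (0, l%:Z, l%:Z * c), (0, 0, l%:Z ^+ 2).
  split; last by vsimp; ring.
  + apply/and4P; split; vsimp.
    * by apply: (dvdz_lin1 (f := - v2) (l1 _ hu)); ring.
    * by apply: (dvdz_lin1 (f := 0) (l1 _ hu)); ring.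
    * by apply: (dvdz_lin1 (f := v3) (l1 _ hu)); ring.
    * by apply: (dvdz_lin2 (f := u) (g := - v1) hv hu); vsimp; ring.
  + apply/and4P; split; vsimp.
    * by apply: (l0 (- v1)); ring.
    * by apply: (l0 (v3 - c * v2)); ring.
    * by apply: (l0 (c * v1)); ring.
    * by apply: (ll _ _ hc); ring.
  + apply/and4P; split; vsimp.
    * by apply: (l2 0); ring.
    * by apply: (l2 (- v2)); ring.
    * by apply: (l2 v1); ring.
    * by apply: (l3 v3); ring.
- move=> hp hq; have [u [c [hu hc]]] := aux _ _ v3 hp hq.
  exists (u * v1, 1, u * v3), (l%:Z * c, 0, l%:Z), (l%:Z ^+ 2, 0, 0).
  split; last by vsimp; ring.
  + apply/and4P; split; vsimp.
    * by apply: (dvdz_lin1 (f := v1) (l1 _ hu)); ring.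
    * by apply: (dvdz_lin1 (f := - v3) (l1 _ hu)); ring.
    * by apply: (dvdz_lin1 (f := 0) (l1 _ hu)); ring.
    * by apply: (dvdz_lin2 (f := u) (g := - v2) hv hu); vsimp; ring.
  + apply/and4P; split; vsimp.
    * by apply: (l0 (c * v2)); ring.
    * by apply: (l0 (- v2)); ring.
    * by apply: (l0 (v1 - c * v3)); ring.
    * by apply: (ll _ _ hc); ring.
  + apply/and4P; split; vsimp.
    * by apply: (l2 v2); ring.
    * by apply: (l2 0); ring.
    * by apply: (l2 (- v3)); ring.
    * by apply: (l3 v1); ring.
Qed.

End Neighbour.

(** * Vectors of given norm, in Z^3 and in a neighbour *)

Definition zrange (n : nat) : seq int := [seq i%:Z - n%:Z | i <- iota 0 n.*2.+1].

Lemma mem_zrange n (x : int) : (x \in zrange n) = (`|x| <= n%:Z).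
Proof.
apply/mapP/idP => [[i]|h]; first by rewrite mem_iota => h ->; lia.
exists `|(x + n%:Z)%R|%N; last by lia.
by rewrite mem_iota; lia.
Qed.

Lemma zrange_uniq n : uniq (zrange n).
Proof. by rewrite map_inj_uniq ?iota_uniq // => i j; lia. Qed.

Definition box (n : nat) : seq vec :=
  [seq (xy, z) | xy <- [seq (x, y) | x <- zrange n, y <- zrange n], z <- zrange n].

Lemma mem_box n v :
  (v \in box n) = [&& `|v.1.1| <= n%:Z, `|v.1.2| <= n%:Z & `|v.2| <= n%:Z].
Proof.
case: v => [[x y] z] /=; rewrite -!mem_zrange.
apply/allpairsP/and3P => [[q [hp hz [ep ->]]]|[hx hy hz]].
  by case/allpairsP: hp => r [hx hy]; rewrite -ep => -[-> ->].
exists ((x, y), z); split=> //.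
by apply/allpairsP; exists (x, y).
Qed.

Lemma box_uniq n : uniq (box n).
Proof.
by rewrite !allpairs_uniq ?zrange_uniq // => -[? ?] [? ?] _ _ [-> ->].
Qed.

Definition sphere (n : nat) : seq vec := [seq v <- box n | dot v v == n%:Z].

Lemma sphere_uniq n : uniq (sphere n).
Proof. by rewrite filter_uniq ?box_uniq. Qed.

Lemma mem_sphere n v : (v \in sphere n) = (dot v v == n%:Z).
Proof.
rewrite mem_filter andb_idr // => /eqP hv; rewrite mem_box.
by move: hv; case: v => [[x y] z]; vsimp => h; apply/and3P; split; nia.
Qed.

Definition r3 (n : nat) : nat := size (sphere n).

(** An orthogonal basis of vectors of norm l^2 gives a similarity [f] from Z^3 multiplying norms by
    l^2. It is onto [nbhd l v], since by [nbhd_dot] the coordinates [dot x ei / l^2] are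
    integers. *)
Lemma count_nbhd (l : nat) (v : vec) (n : nat) : prime l ->
  ((l%:Z ^+ 2)%R %| dot v v)%Z -> ~~ vec0mod l v ->
  count (nbhd l v) (sphere (l ^ 2 * n)) = r3 n.
Proof.
move=> lp hv nv.
have l0 : 0 < l%:Z ^+ 2 by rewrite exprn_gt0 // ltz_nat prime_gt0.
have [] := @orthogonal_basis (l%:Z ^+ 2) (nbhd l v) l0 _ _ (nbhd_triple lp hv nv).
- by move=> k x y; apply: nbhd_lcomb.
- by move=> x y; apply: nbhd_dot.
move=> e1 [e2 [e3 [[M1 M2 M3] [[q1 q2 q3] [o12 o13 o23]]]]].
pose f (y : vec) : vec := lcomb y.1.1 (lcomb y.1.2 (lcomb y.2 (0,0,0) e3) e2) e1.
have fdot x y : dot (f x) (f y) = l%:Z ^+ 2 * dot x y.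
  transitivity (x.1.1 * y.1.1 * dot e1 e1 + x.1.2 * y.1.2 * dot e2 e2 +
     x.2 * y.2 * dot e3 e3 + (x.1.1 * y.1.2 + x.1.2 * y.1.1) * dot e1 e2 +
     (x.1.1 * y.2 + x.2 * y.1.1) * dot e1 e3 +
     (x.1.2 * y.2 + x.2 * y.1.2) * dot e2 e3).
    by rewrite /f; vsimp; ring.
  by rewrite q1 q2 q3 o12 o13 o23; vsimp; ring.
have fe1 x : dot (f x) e1 = l%:Z ^+ 2 * x.1.1.
  transitivity (x.1.1 * dot e1 e1 + x.1.2 * dot e1 e2 + x.2 * dot e1 e3).
    by rewrite /f; vsimp; ring.
  by rewrite q1 o12 o13; ring.
have fe2 x : dot (f x) e2 = l%:Z ^+ 2 * x.1.2.
  transitivity (x.1.1 * dot e1 e2 + x.1.2 * dot e2 e2 + x.2 * dot e2 e3).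
    by rewrite /f; vsimp; ring.
  by rewrite q2 o12 o23; ring.
have fe3 x : dot (f x) e3 = l%:Z ^+ 2 * x.2.
  transitivity (x.1.1 * dot e1 e3 + x.1.2 * dot e2 e3 + x.2 * dot e3 e3).
    by rewrite /f; vsimp; ring.
  by rewrite q3 o13 o23; ring.
have l0' : l%:Z ^+ 2 != 0 by rewrite gt_eqF.
have finj : injective f.
  move=> x y E; move: (fe1 x) (fe2 x) (fe3 x); rewrite E fe1 fe2 fe3.
  case: x y {E} => [[x1 x2] x3] [[y1 y2] y3] /=.
  by move=> /(mulfI l0') -> /(mulfI l0') -> /(mulfI l0') ->.
rewrite -size_filter /r3 -(size_map f (sphere n)); apply/perm_size/uniq_perm.
- by rewrite filter_uniq ?sphere_uniq.
- by rewrite map_inj_uniq ?sphere_uniq.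
move=> x; rewrite mem_filter mem_sphere; apply/andP/mapP.
- case=> Mx /eqP qx.
  have /dvdzP[y1 h1] := nbhd_dot lp hv nv Mx M1.
  have /dvdzP[y2 h2] := nbhd_dot lp hv nv Mx M2.
  have /dvdzP[y3 h3] := nbhd_dot lp hv nv Mx M3.
  pose y : vec := (y1, y2, y3).
  have : f y = x.
    (* The difference [x - f y] is orthogonal to the basis, hence 0 by Cramer's rule; the
       coefficients fed to [zi] below are cofactors. *)
    pose z := lcomb (- 1) x (f y).
    have z1 : dot z e1 = 0.
      transitivity (dot x e1 - dot (f y) e1); first by rewrite /z; vsimp; ring.
      by rewrite h1 fe1 /y /=; ring.
    have z2 : dot z e2 = 0.
      transitivity (dot x e2 - dot (f y) e2); first by rewrite /z; vsimp; ring.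
      by rewrite h2 fe2 /y /=; ring.
    have z3 : dot z e3 = 0.
      transitivity (dot x e3 - dot (f y) e3); first by rewrite /z; vsimp; ring.
      by rewrite h3 fe3 /y /=; ring.
    have dz : det3 e1 e2 e3 != 0.
      have : det3 e1 e2 e3 ^+ 2 = dot e1 e1 * dot e2 e2 * dot e3 e3
         - dot e1 e1 * dot e2 e3 ^+ 2 - dot e2 e2 * dot e1 e3 ^+ 2
         - dot e3 e3 * dot e1 e2 ^+ 2 + 2 * dot e1 e2 * dot e1 e3 * dot e2 e3.
        by vsimp; ring.
      rewrite q1 q2 q3 o12 o13 o23 => E; apply/eqP => E0.
      move: E; rewrite E0 expr0n /= !(mulr0, subr0, addr0) => /esym/eqP.
      by apply/negP; rewrite mulf_neq0 // mulf_neq0.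
    have zi (a b c : int) : a * dot z e1 + b * dot z e2 + c * dot z e3 = 0.
      by rewrite z1 z2 z3; ring.
    have zx : z.1.1 = 0.
      apply: (mulfI dz); rewrite mulr0 -(zi (e2.1.2 * e3.2 - e2.2 * e3.1.2)
        (e3.1.2 * e1.2 - e3.2 * e1.1.2) (e1.1.2 * e2.2 - e1.2 * e2.1.2)).
      by move: z {z1 z2 z3 zi} => z; vsimp; ring.
    have zy : z.1.2 = 0.
      apply: (mulfI dz); rewrite mulr0 -(zi (e2.2 * e3.1.1 - e2.1.1 * e3.2)
        (e3.2 * e1.1.1 - e3.1.1 * e1.2) (e1.2 * e2.1.1 - e1.1.1 * e2.2)).
      by move: z {z1 z2 z3 zi zx} => z; vsimp; ring.
    have zz : z.2 = 0.
      apply: (mulfI dz); rewrite mulr0 -(zi (e2.1.1 * e3.1.2 - e2.1.2 * e3.1.1)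
        (e3.1.1 * e1.1.2 - e3.1.2 * e1.1.1) (e1.1.1 * e2.1.2 - e1.1.2 * e2.1.1)).
      by move: z {z1 z2 z3 zi zx zy} => z; vsimp; ring.
    move: zx zy zz; rewrite /z; case: (x) (f y) => [[x1 x2] x3] [[w1 w2] w3]; rewrite /lcomb /=.
    by clear=> a1 a2 a3; congr (_, _, _); lia.
  move=> E; exists y => //; rewrite mem_sphere; apply/eqP; apply: (mulfI l0').
  by rewrite -fdot E qx PoszM.
- case=> y; rewrite mem_sphere => /eqP qy ->; split.
    have M0 : nbhd l v (0,0,0).
      by apply/and4P; split; vsimp; rewrite !mul0r ?subr0 ?addr0 dvdz0.
    by rewrite /f !nbhd_lcomb.
  by rewrite fdot qy PoszM.
Qed.

(** * The Legendre symbol *)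

Section Quadratic.

Variable p : nat.
Hypothesis p_prime : prime p.
Hypothesis p_odd : odd p.

Lemma dvdz_Fp (x : int) : (p %| x)%Z = (x%:~R == 0 :> 'F_p).
Proof. exact: (dvdz_pcharf (pchar_Fp p_prime)). Qed.

Lemma Fp_lift (s : 'F_p) : exists2 i : nat, (i < p)%N & s = i%:R.
Proof.
exists s; last by rewrite natr_Zp.
by rewrite -[X in (_ < X)%N](Fp_cast p_prime) ltn_ord.
Qed.

Lemma Fp2_neq0 : (2%:R : 'F_p) != 0.
Proof.
rewrite -[2%:R]/(2%:~R) -dvdz_Fp dvdzE /=.
by apply/negP => /dvdn_leq => /(_ isT); move: (prime_gt1 p_prime) p_odd; case: p => [|[|[|]]].
Qed.

Lemma card_sqrt (a : int) :
  #|[pred s : 'F_p | s ^+ 2 == a%:~R]|%:Z = 1 + legendre a p.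
Proof.
rewrite /legendre dvdz_Fp; case: eqP => [->|/eqP a0].
  rewrite addr0 (eq_card (B := pred1 (0 : 'F_p))) ?card1 // => s.
  by rewrite !inE expf_eq0.
case: existsP => [[x /eqP hx]|hx].
  pose s : 'F_p := (x : nat)%:R.
  have hs : s ^+ 2 = a%:~R.
    apply/eqP; rewrite -subr_eq0 -[s]/((x%:Z)%:~R) -rmorphXn -rmorphB /= -dvdz_Fp.
    by rewrite -eqz_mod_dvd hx.
  have s0 : s != 0 by apply: contraNneq a0 => s0; rewrite -hs s0 expr0n.
  rewrite (eq_card (B := pred2 s (- s))); last first.
    by move=> t; rewrite !inE -hs eqf_sqr.
  rewrite card2 -addr_eq0 -mulr2n -mulr_natl mulf_eq0 (negbTE s0) orbF.
  by rewrite (negbTE Fp2_neq0).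
rewrite subrr eq_card0 // => s; rewrite !inE; apply/negP => /eqP hs; apply: hx.
have [i ip si] := Fp_lift s.
exists (Ordinal ip) => /=; rewrite eqz_mod_dvd dvdz_Fp rmorphB rmorphXn /=.
by rewrite -hs si subrr.
Qed.

(** Zeros on the projective line of a quadratic in [t]: infinity is a zero exactly when [G = 0], and
    otherwise completing the square with [t = (s + F) / G] matches the zeros with the square roots
    of the discriminant. *)
Lemma card_conic_line (E F G : 'F_p) :
  (#|[pred t : 'F_p | (E + 2%:R * t * F - t ^+ 2 * G == 0)%R]| + (G == 0)%R)%N =
   if [&& E == 0, F == 0 & G == 0] then p.+1
   else #|[pred s : 'F_p | s ^+ 2 == F ^+ 2 + E * G]|.
Proof.
have n2 := Fp2_neq0.
case: (eqVneq G 0) => [->|G0]; rewrite ?andbT ?andbF /=; last first.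
  rewrite addn0 -!sum1_card.
  rewrite (reindex (fun s => (s + F) / G)) /=; last first.
    exists (fun t => G * t - F) => t _; first by field.
    by field.
  apply: eq_bigl => s; rewrite !inE.
  rewrite (_ : _ + _ - _ = (F ^+ 2 + E * G - s ^+ 2) / G); last by field.
  by rewrite mulf_eq0 invr_eq0 (negbTE G0) orbF subr_eq0 eq_sym.
case: (eqVneq F 0) => [->|F0] /=; rewrite ?andbT ?andbF.
  case: (eqVneq E 0) => [->|E0].
    rewrite (eq_card (B := predT)); last by move=> t; rewrite !inE !(mulr0, addr0, subr0) eqxx.
    by rewrite (card_Fp p_prime) addn1.
  rewrite eq_card0; last first.
    by move=> t; rewrite !inE !(mulr0, addr0, subr0) (negbTE E0).
  rewrite (eq_card (B := pred1 (0 : 'F_p))) ?card1 // => s.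
  by rewrite !inE expr0n mulr0 addr0 expf_eq0.
rewrite (eq_card (B := pred1 (- E / (2%:R * F)))); last first.
  move=> t; rewrite !inE mulr0 subr0; apply/eqP/eqP => [h|->]; last by field; rewrite n2 F0.
  apply: (mulfI F0); apply: (mulfI n2).
  rewrite -[RHS]addr0 -h; field.
  by rewrite n2 F0.
rewrite card1 (eq_card (B := pred2 F (- F))); last by move=> t; rewrite !inE mulr0 addr0 eqf_sqr.
by rewrite card2 -addr_eq0 -mulr2n -mulr_natl mulf_eq0 (negbTE n2) (negbTE F0).
Qed.

(** Squaring has fibres of at most two elements, and the inequality is strict because [p] is odd. *)
Lemma card_squares : (p < 2 * #|[set x ^+ 2 | x : 'F_p]|)%N.
Proof.
set S := imset _ _.
suff : (p <= 2 * #|S|)%N by lia.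
rewrite -{1}(card_Fp p_prime) -[#|'F_p|]sum1_card.
rewrite (partition_big (fun x : 'F_p => x ^+ 2) (mem S)) /=; last first.
  by move=> x _; apply: imset_f.
rewrite mulnC -(sum_nat_const (mem S) 2); apply: leq_sum => d /imsetP[x _ ->].
rewrite sum1_card; apply: (@leq_trans #|pred2 x (- x)|).
  by apply/subset_leq_card/subsetP => y; rewrite unfold_in => h; rewrite !inE -eqf_sqr; exact: h.
by rewrite card2; case: (_ != _).
Qed.

(* Pigeonhole: the squares and the values [-1 - y^2] both fill more than half of the field. *)
Lemma sum_two_squares_m1 : exists a b : 'F_p, a ^+ 2 + b ^+ 2 + 1 = 0.
Proof.
pose S := [set x ^+ 2 | x : 'F_p].
have cS : (p < 2 * #|S|)%N := card_squares.
pose T := [set - 1 - x | x in S].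
have cT : #|T| = #|S|.
  by rewrite card_imset // => x y /addrI /oppr_inj.
have /set0Pn[z] : S :&: T != set0.
  apply: contraTneq cS => ST0; rewrite -leqNgt mul2n -addnn -{2}cT -cardsUI ST0 cards0 addn0.
  by rewrite -[X in (_ <= X)%N](card_Fp p_prime) max_card.
rewrite inE => /andP[/imsetP[a _ ->] /imsetP[y /imsetP[b _ ->] E]].
by exists a, b; rewrite E; ring.
Qed.

Lemma Fp_expf_pred (x : 'F_p) : x != 0 -> x ^+ (2 * p./2) = 1.
Proof.
move=> x0; apply: (mulfI x0); rewrite -exprS mulr1 mul2n.
have -> : (p./2).*2.+1 = #|'F_p|.
  by rewrite card_Fp // -[RHS]odd_double_half p_odd.
exact: expf_card.
Qed.

Lemma half_gt0 : (0 < p./2)%N.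
Proof. by move: (prime_gt1 p_prime) p_odd; case: p => [|[|[|]]]. Qed.

(** Otherwise [x] and all nonzero squares would be roots of ['X^(p./2) - 1], more than its degree
    permits. *)
Lemma nonsquare_expf (x : 'F_p) : x != 0 -> (forall s, s ^+ 2 != x) -> x ^+ p./2 = -1.
Proof.
move=> x0 xs.
have : (x ^+ p./2) ^+ 2 == 1 by rewrite -exprM mulnC Fp_expf_pred.
rewrite sqrf_eq1 => /orP[/eqP x1|/eqP //].
pose S := [set s ^+ 2 | s : 'F_p].
have root1 y : y ^+ p./2 = 1 -> root ('X^(p./2) - 1) y.
  by move=> y1; rewrite rootE hornerD hornerN hornerXn hornerC y1 subrr.
have := @max_poly_roots _ ('X^(p./2) - 1) (x :: enum (S :\ 0)).
rewrite -size_poly_gt0 size_XnsubC ?half_gt0 // => /(_ isT).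
have -> : all (root ('X^(p./2) - 1)) (x :: enum (S :\ 0)).
  rewrite /= root1 //; apply/allP => y; rewrite mem_enum !inE => /andP[y0 /imsetP[s _ ys]].
  apply: root1; rewrite ys -exprM Fp_expf_pred //.
  by apply: contraNneq y0 => s0; rewrite ys s0 expr0n.
have -> : uniq (x :: enum (S :\ 0)).
  rewrite /= enum_uniq andbT mem_enum !inE x0 /=; apply/imsetP => -[s _ xE].
  by have := xs s; rewrite -xE eqxx.
move=> /(_ isT isT) /=; rewrite ltnS -cardE.
have := cardsD1 0 S; rewrite (_ : 0 \in S); last by apply/imsetP; exists 0; rewrite ?expr0n.
have := card_squares; rewrite -/S; have := odd_double_half p; rewrite p_odd.
set a := #|S|; set b := #|_|; lia.
Qed.

Lemma euler_criterion (a : int) : (legendre a p)%:~R = a%:~R ^+ p./2 :> 'F_p.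
Proof.
have cs := card_sqrt a; move: cs; rewrite /legendre dvdz_Fp.
case: (eqVneq (a%:~R : 'F_p) 0) => [-> _|a0].
  by rewrite expr0n gtn_eqF ?half_gt0.
case: ifP => _ cs.
  have /card_gt0P[s] : (0 < #|[pred s : 'F_p | s ^+ 2 == a%:~R]|)%N by rewrite -ltz_nat cs.
  rewrite inE => /eqP sa; rewrite -sa -exprM Fp_expf_pred //.
  by apply: contraNneq a0 => s0; rewrite -sa s0 expr0n.
rewrite nonsquare_expf // => s; move: cs; rewrite subrr => /eqP; rewrite eqz_nat => /eqP cs.
by have := card0_eq cs s; rewrite !inE => ->.
Qed.

Lemma legendre_range (a : int) : [\/ legendre a p = 0, legendre a p = 1 | legendre a p = -1].
Proof. by rewrite /legendre; case: ifP => _; [constructor 1|case: ifP;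
  [constructor 2|constructor 3]]. Qed.

(** The values 0, 1, -1 stay distinct modulo an odd prime, so identities for the symbol can be
    checked on powers in ['F_p]. *)
Lemma legendre_eq (a : int) (c : int) : [\/ c = 0, c = 1 | c = -1] ->
  c%:~R = a%:~R ^+ p./2 :> 'F_p -> legendre a p = c.
Proof.
move=> hc; rewrite -euler_criterion => /esym/eqP; rewrite -subr_eq0 -rmorphB -dvdz_Fp dvdzE.
case: (legendre_range a) => ->; case: hc => -> //=; move: (prime_gt1 p_prime) p_odd;
  by case: p => [|[|[|]]].
Qed.

Lemma legendreM (a b : int) : legendre (a * b) p = legendre a p * legendre b p.
Proof.
apply: legendre_eq; last by rewrite !rmorphM /= exprMn !euler_criterion.
by case: (legendre_range a) => ->; case: (legendre_range b) => ->;
  rewrite ?mulr0 ?mul0r ?mulr1 ?mul1r ?opprK; auto using or3.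
Qed.

Lemma legendre_sqr (a : int) : ~~ (p %| a)%Z -> legendre (a ^+ 2) p = 1.
Proof.
move=> pa; apply: legendre_eq; first by constructor 2.
rewrite rmorphXn -exprM Fp_expf_pred //= -dvdz_Fp //.
Qed.

Lemma legendre_m1 : legendre (-1) p = (-1) ^+ p./2.
Proof.
apply: legendre_eq; last by rewrite rmorphXn rmorphN1.
by rewrite -signr_odd; case: odd; [constructor 3|constructor 2].
Qed.

(* In the matrix ring, J^2 = -1 and (1 + J)^2 = 2 J, and the Frobenius map is additive on 1, J. *)
Lemma legendre_2 : legendre 2 p = (-1) ^+ (p./2.+1)./2.
Proof.
apply: legendre_eq; first by rewrite -signr_odd; case: odd; [constructor 3|constructor 2].
rewrite rmorphXn rmorphN1 /=.
pose J : 'M['F_p]_2 := \matrix_(i, j) ((j == 1)%:R - (i == 1)%:R).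
have J2 : J ^+ 2 = -1.
  apply/matrixP => i j; rewrite expr2 !mxE !big_ord_recl big_ord0 !mxE.
  by case: i => -[|[|[]]] //= i2; case: j => -[|[|[]]] //= j2; rewrite /= ?mulr0n ?mulr1n; ring.
have pc : p \in [pchar 'M['F_p]_2] by rewrite pchar_lalg pchar_Fp.
have := pFrobenius_autD_comm pc (commr_sym (commr1 J)); rewrite !pFrobenius_autE expr1n.
have pw (M : 'M['F_p]_2) : M ^+ p = (M ^+ 2) ^+ p./2 * M.
  by rewrite -exprM -exprSr; congr (_ ^+ _); rewrite mul2n -[LHS]odd_double_half p_odd.
have J12 : (1 + J) ^+ 2 = 2%:R *: J.
  rewrite expr2 mulrDl mul1r mulrDr mulr1 -expr2 J2 [1 + J]addrC addrACA subrr addr0.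
  by rewrite scaler_nat mulr2n.
rewrite !pw J12 J2 exprZn -scalerAl.
rewrite -[2%:~R]/(2%:R : 'F_p) -!(signr_odd _ p./2) -(signr_odd _ (uphalf _)).
have Jh k : (J ^+ (2 * k) = (-1) ^+ odd k) /\ (J ^+ (2 * k).+1 = (-1) ^+ odd k * J).
  by rewrite exprSr exprM J2 signr_odd.
(* With h = [p./2], the Frobenius relation now reads 2^h J^h (1 + J) = 1 + (-1)^h J; since
   [J 0 0 = 0], the upper left entry alone determines 2^h. *)
have entry (c : 'F_p) (M M' : 'M['F_p]_2) : c *: M = M' -> c * M 0 0 = M' 0 0.
  by move=> <-; rewrite mxE.
have J00 : J 0 0 = 0 by rewrite mxE subrr.
have one00 : (1 : 'M['F_p]_2) 0 0 = 1 by rewrite mxE.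
have add00 (M M' : 'M['F_p]_2) : (M + M') 0 0 = M 0 0 + M' 0 0 by rewrite mxE.
have opp00 (M : 'M['F_p]_2) : (- M) 0 0 = - M 0 0 by rewrite mxE.
have JJ : J * (1 + J) = J - 1 by rewrite mulrDr mulr1 -expr2 J2.
have [k [hk|hk]] : exists k, p./2 = (2 * k)%N \/ p./2 = (2 * k).+1.
  by exists (p./2)./2; lia.
- have -> : odd p./2 = false by lia.
  have -> : odd (uphalf p./2) = odd k by congr odd; lia.
  rewrite hk (Jh k).1 !expr0 mul1r; case: (odd k); rewrite ?expr0 ?expr1 ?mul1r ?mulN1r => /entry.
    by rewrite opp00 !add00 J00 one00 addr0 mulrN1 => h; rewrite -[RHS]opprK h.
  by rewrite !add00 J00 one00 addr0 mulr1 => ->.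
- have -> : odd p./2 = true by lia.
  have -> : odd (uphalf p./2) = ~~ odd k by rewrite -oddS; congr odd; lia.
  rewrite hk (Jh k).2 -mulrA JJ !expr1 mulN1r; case: (odd k);
    rewrite ?expr0 ?expr1 ?mul1r ?mulN1r => /entry.
    by rewrite opp00 !add00 !opp00 J00 one00 sub0r opprK oppr0 addr0 mulr1 => ->.
  by rewrite !add00 !opp00 J00 one00 sub0r oppr0 addr0 mulrN1 => h; rewrite -[RHS]opprK h.
Qed.

End Quadratic.

(** * The Hecke relation for sums of three squares *)

Section Hecke.

Variable l : nat.
Hypothesis l_prime : prime l.
Hypothesis l_odd : odd l.

Lemma coprimez_double (x : int) : ~~ (l %| x)%Z -> coprimez l (2 * x).
Proof.
move=> lx; rewrite coprimezMr (coprimez_prime l_prime x) lx andbT coprimezE /=.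
by rewrite coprimen2.
Qed.

(** One step of Hensel lifting: with [w] inverse to [2 i] modulo [l], replacing [i] by [i - l q w]
    removes the term [l q]. It applies because [i] and [j] cannot both vanish modulo [l]. *)
Lemma sum_two_squares_m1_mod_sqr : exists a b : int,
  ((l%:Z ^+ 2)%R %| a ^+ 2 + b ^+ 2 + 1)%Z.
Proof.
have lift (i j : int) : ~~ (l %| i)%Z -> (l %| i ^+ 2 + j ^+ 2 + 1)%Z ->
    exists a b : int, ((l%:Z ^+ 2)%R %| a ^+ 2 + b ^+ 2 + 1)%Z.
  move=> hi /dvdzP[q hq].
  have [w /dvdzP[c hw]] := unit_inv (coprimez_double hi).
  exists (i - l%:Z * q * w), j; apply/dvdzP; exists (- q * c + q ^+ 2 * w ^+ 2).
  have -> : (i - l%:Z * q * w) ^+ 2 + j ^+ 2 + 1 =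
      (i ^+ 2 + j ^+ 2 + 1) - l%:Z * q * (w * (2 * i) - 1) - l%:Z * q + l%:Z ^+ 2 * q ^+ 2 * w ^+ 2.
    by ring.
  by rewrite hq hw; ring.
have [a [b]] := sum_two_squares_m1 l_prime l_odd.
have [i _ ->] := Fp_lift l_prime a; have [j _ ->] := Fp_lift l_prime b.
have -> : i%:R = (i%:Z)%:~R :> 'F_l by [].
have -> : j%:R = (j%:Z)%:~R :> 'F_l by [].
move: (i%:Z) (j%:Z) => {}i {}j h0.
have {h0} h : (l %| i ^+ 2 + j ^+ 2 + 1)%Z.
  by rewrite (dvdz_Fp l_prime) !rmorphD !rmorphXn /= h0.
case: (boolP (l %| i)%Z) => [hi|hi]; last first.
  by apply: (lift i j).
case: (boolP (l %| j)%Z) => [hj|hj]; last first.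
  by apply: (lift j i hj); rewrite [j ^+ 2 + _]addrC.
have : (l %| (1 : int))%Z.
  by apply: (dvdz_lin3 (f := 1) (g := - i) (h := - j) h hi hj); ring.
by rewrite dvdzE dvdn1 => /eqP l1; move: l_prime; rewrite (l1 : l = 1%N).
Qed.

Section Lines.

Variables (a b : int).
Hypothesis ab : ((l%:Z ^+ 2)%R %| a ^+ 2 + b ^+ 2 + 1)%Z.

(* The isotropic lines mod l: with e = (a, b, 1), f = (-b, a, 0), g = (a, b, -1),
   the point t of the projective line gives e + 2 t f - t^2 g, and infinity gives g. *)
Definition isoline (t : option 'F_l) : vec :=
  if t is Some s then
    let t := (nat_of_ord s)%:Z in
    (a - 2 * t * b - t ^+ 2 * a, b + 2 * t * a - t ^+ 2 * b, 1 + t ^+ 2)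
  else (a, b, -1).

Lemma isoline_dot t : ((l%:Z ^+ 2)%R %| dot (isoline t) (isoline t))%Z.
Proof.
case: t => [s|] /=; last by apply: (dvdz_lin1 (f := 1) ab); vsimp; ring.
by apply: (dvdz_lin1 (f := (1 + (s : nat)%:Z ^+ 2) ^+ 2) ab); vsimp; ring.
Qed.

Let abl : (l %| a ^+ 2 + b ^+ 2 + 1)%Z.
Proof. by apply: dvdz_trans ab; rewrite expr2 dvdz_mulr. Qed.

Let two_unit : coprimez l 2.
Proof. by rewrite coprimezE /= coprimen2. Qed.

Let n1 : ~~ (l %| (1 : int))%Z.
Proof.
by rewrite dvdzE dvdn1; apply: contraTN l_prime => /eqP h; rewrite (h : l = 1%N).
Qed.

Lemma isoline_neq0 t : ~~ vec0mod l (isoline t).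
Proof.
case: t => [s|]; rewrite /vec0mod /=; last first.
  by apply/and3P => -[_ _]; rewrite rpredN; apply/negP.
set t := (s : nat)%:Z; apply/and3P => -[h1 h2 h3]; case/negP: n1.
have g1 : (l %| a - t * b)%Z.
  rewrite -(Gauss_dvdzr _ two_unit).
  by apply: (dvdz_lin2 (f := 1) (g := a) h1 h3); ring.
have g2 : (l %| b + t * a)%Z.
  rewrite -(Gauss_dvdzr _ two_unit).
  by apply: (dvdz_lin2 (f := 1) (g := b) h2 h3); ring.
have g3 : (l %| a ^+ 2 + b ^+ 2)%Z.
  by apply: (dvdz_lin2 (f := a) (g := b) g1 g2); ring.
by apply: (dvdz_lin2 (f := 1) (g := -1) abl g3); ring.
Qed.

(** In dimension three, orthogonal isotropic vectors are proportional modulo [l]: the squared minors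
    are combinations of the three products. If [v1] and [x1] are prime to [l], then [v1 x - x1 v]
    vanishes modulo [l], so its norm is divisible by l^2; up to multiples of [dot x x] and [dot v v]
    that norm is [- 2 x1 v1 dot x v]. *)
Lemma dot_mod_sqr (x : vec) (t : option 'F_l) :
  ((l%:Z ^+ 2)%R %| dot x x)%Z -> ~~ vec0mod l x ->
  nbhd l (isoline t) x = (l %| dot x (isoline t))%Z.
Proof.
move: (isoline_dot t) (isoline_neq0 t); move: (isoline t) => v vv v0 xx x0.
apply/idP/idP.
  by case/and4P => _ _ _; apply: dvdz_trans; rewrite expr2 dvdz_mulr.
move=> xv.
have xxl : (l %| dot x x)%Z by apply: dvdz_trans xx; rewrite expr2 dvdz_mulr.
have vvl : (l %| dot v v)%Z by apply: dvdz_trans vv; rewrite expr2 dvdz_mulr.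
have sq (z : int) : (l %| z ^+ 2)%Z -> (l %| z)%Z by rewrite expr2 Euclid_dvdz // orbb.
case: v x vv v0 xx x0 xv xxl vvl => [[v1 v2] v3] [[x1 x2] x3].
move=> vv v0 xx x0 xv xxl vvl.
have c12 : (l %| x1 * v2 - x2 * v1)%Z.
  apply: sq; apply: (dvdz_lin3 (f := dot (v1, v2, v3) (v1, v2, v3) - v3 ^+ 2) (g := - x3 ^+ 2)
     (h := 2 * x3 * v3 - dot (x1, x2, x3) (v1, v2, v3)) xxl vvl xv); vsimp; ring.
have c23 : (l %| x2 * v3 - x3 * v2)%Z.
  apply: sq; apply: (dvdz_lin3 (f := dot (v1, v2, v3) (v1, v2, v3) - v1 ^+ 2) (g := - x1 ^+ 2)
     (h := 2 * x1 * v1 - dot (x1, x2, x3) (v1, v2, v3)) xxl vvl xv); vsimp; ring.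
have c31 : (l %| x3 * v1 - x1 * v3)%Z.
  apply: sq; apply: (dvdz_lin3 (f := dot (v1, v2, v3) (v1, v2, v3) - v2 ^+ 2) (g := - x2 ^+ 2)
     (h := 2 * x2 * v2 - dot (x1, x2, x3) (v1, v2, v3)) xxl vvl xv); vsimp; ring.
have fin (z w : int) : ~~ (l %| z)%Z -> ~~ (l %| w)%Z ->
    ((l%:Z ^+ 2)%R %| (2 * (z * w)) * dot (x1, x2, x3) (v1, v2, v3))%Z ->
    nbhd l (v1, v2, v3) (x1, x2, x3).
  move=> hz hw; rewrite Gauss_dvdzr; last first.
    by rewrite coprimez_pexpl // coprimez_double // Euclid_dvdz // negb_or hz.
  by move=> h; apply/and4P; split.
have sq2 (c : int) : (l %| c)%Z -> (l%:Z ^+ 2 %| c ^+ 2)%Z.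
  by move=> hc; rewrite [c ^+ 2]expr2 dvdz_sqr_mul.
have key (f g c e : int) : (l %| c)%Z ->
   e = f * dot (x1, x2, x3) (x1, x2, x3) + g * dot (v1, v2, v3) (v1, v2, v3)
     + (dot (x1, x2, x3) (v1, v2, v3) ^+ 2 + c ^+ 2) -> (l%:Z ^+ 2 %| e)%Z.
  by move=> hc ->; apply: rpredD; apply: rpredD; first [exact: dvdz_mull | exact: sq2].
have div2 (x y z w : int) : (l %| x * y - z * w)%Z -> ~~ (l %| x)%Z -> (l %| w)%Z -> (l %| y)%Z.
  move=> h hx hw; suff : (l %| x * y)%Z by rewrite Euclid_dvdz // (negbTE hx).
  by apply: (dvdz_lin2 (f := 1) (g := z) h hw); ring.
have div3 (x y z w : int) : (l %| z * w - x * y)%Z -> ~~ (l %| x)%Z -> (l %| w)%Z -> (l %| y)%Z.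
  by rewrite -opprB rpredN; apply: div2.
move: (x0) (v0); rewrite /vec0mod /=.
case: (boolP (l %| x1)%Z) => h1; last first.
  case: (boolP (l %| v1)%Z) => g1.
    by rewrite (div2 _ _ _ _ c12 h1 g1) (div3 _ _ _ _ c31 h1 g1).
  move=> _ _; apply: (fin _ _ h1 g1).
  by apply: (key (v1 ^+ 2 - dot (v1, v2, v3) (v1, v2, v3)) (x1 ^+ 2) _ _ c23); vsimp; ring.
case: (boolP (l %| x2)%Z) => h2; last first.
  case: (boolP (l %| v2)%Z) => g2.
    by rewrite (div2 _ _ _ _ c23 h2 g2) (div3 _ _ _ _ c12 h2 g2).
  move=> _ _; apply: (fin _ _ h2 g2).
  by apply: (key (v2 ^+ 2 - dot (v1, v2, v3) (v1, v2, v3)) (x2 ^+ 2) _ _ c31); vsimp; ring.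
case: (boolP (l %| x3)%Z) => h3 //.
case: (boolP (l %| v3)%Z) => g3.
  by rewrite (div2 _ _ _ _ c31 h3 g3) (div3 _ _ _ _ c23 h3 g3).
move=> _ _; apply: (fin _ _ h3 g3).
by apply: (key (v3 ^+ 2 - dot (v1, v2, v3) (v1, v2, v3)) (x3 ^+ 2) _ _ c12); vsimp; ring.
Qed.

Lemma card_isoline_orthogonal (y : vec) :
  #|[pred t | (l %| dot y (isoline t))%Z]|%:Z =
  if vec0mod l y then l.+1%:Z else 1 + legendre (- dot y y) l.
Proof.
case: y => [[y1 y2] y3].
(* [E], [F], [G] are the products of [y] with e, f, g. These form a basis modulo [l], and the
   discriminant [F ^+ 2 + E * G] is [- dot y y] modulo [l]. *)
pose E := a * y1 + b * y2 + y3; pose F := - b * y1 + a * y2.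
pose G := a * y1 + b * y2 - y3.
have := card_conic_line l_prime l_odd E%:~R F%:~R G%:~R.
rewrite -!(dvdz_Fp l_prime) -rmorphXn -!rmorphM -rmorphD /=.
have -> : [&& (l %| E)%Z, (l %| F)%Z & (l %| G)%Z] = vec0mod l (y1, y2, y3).
  apply/and3P/and3P => /= -[h1 h2 h3]; last first.
    split; first by apply: (dvdz_lin3 (f := a) (g := b) (h := 1) h1 h2 h3); rewrite /E; ring.
      by apply: (dvdz_lin2 (f := - b) (g := a) h1 h2); rewrite /F; ring.
    by apply: (dvdz_lin3 (f := a) (g := b) (h := -1) h1 h2 h3); rewrite /G; ring.
  have h4 : (l %| a * y1 + b * y2)%Z.
    by rewrite -(Gauss_dvdzr _ two_unit); apply: (dvdz_lin2 (f := 1) (g := 1) h1 h3);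
      rewrite /E /G; ring.
  split.
  - rewrite -rpredN; apply: (dvdz_lin3 (f := a) (g := -b) (h := - y1) h4 h2 abl).
    by rewrite /F; ring.
  - rewrite -rpredN; apply: (dvdz_lin3 (f := b) (g := a) (h := - y2) h4 h2 abl).
    by rewrite /F; ring.
  - by apply: (dvdz_lin2 (f := 1) (g := -1) h1 h4); rewrite /E; ring.
have -> : #|[pred t | (l %| dot (y1, y2, y3) (isoline t))%Z]| =
   (#|[pred t : 'F_l | (E%:~R + 2%:R * t * F%:~R - t ^+ 2 * G%:~R == 0)%R]| + (l %| G)%Z)%N.
  rewrite (cardD1 None) addnC; congr (_ + nat_of_bool _)%N; last first.
    rewrite !inE (_ : G = dot (y1, y2, y3) (isoline None)) //.
    by rewrite /G; vsimp; ring.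
  have Some_inj : injective (@Some 'F_l) by move=> u v [].
  rewrite -(card_image Some_inj); apply: eq_card => -[s|]; last first.
    by rewrite !inE /=; apply/esym/imageP => -[].
  rewrite mem_image // !inE.
  have -> : dot (y1, y2, y3) (isoline (Some s)) =
      E + 2 * (s : nat)%:Z * F - (s : nat)%:Z ^+ 2 * G.
    by rewrite /E /F /G; vsimp; ring.
  rewrite (dvdz_Fp l_prime) !(rmorphB, rmorphD, rmorphM, rmorphXn) /=.
  have -> // : (s : nat)%:Z%:~R = s :> 'F_l by rewrite -[RHS]natr_Zp.
move=> ->; case: ifP => // _.
rewrite -(card_sqrt l_prime l_odd); congr (Posz _).
apply: eq_card => s; rewrite !inE; congr (_ == _); apply/eqP.
rewrite -subr_eq0 -rmorphB /= -(dvdz_Fp l_prime).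
by apply: (dvdz_lin1 (f := y1 ^+ 2 + y2 ^+ 2) abl); rewrite /E /F /G; vsimp; ring.
Qed.

End Lines.

Definition r3_div (n : nat) : nat :=
  if (l ^ 2 %| n)%N then r3 (n %/ l ^ 2)%N else 0%N.

Definition scale (k : int) (v : vec) : vec := (k * v.1.1, k * v.1.2, k * v.2).

Lemma dot_scale k v : dot (scale k v) (scale k v) = k ^+ 2 * dot v v.
Proof. by rewrite /scale; vsimp; ring. Qed.

Lemma vec0modP v : reflect (exists y, v = scale l y) (vec0mod l v).
Proof.
case: v => [[v1 v2] v3]; apply: (iffP and3P) => /= [[/dvdzP[a ->] /dvdzP[b ->] /dvdzP[c ->]]|].
  by exists (a, b, c); rewrite /scale /= ![_ * l%:Z]mulrC.
by case=> -[[a b] c] [-> -> ->]; rewrite !dvdz_mulr.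
Qed.

Let l2_gt0 : (0 < l ^ 2)%N. Proof. by rewrite expn_gt0 prime_gt0. Qed.

Let l_neq0 : l%:Z != 0. Proof. by rewrite gt_eqF // ltz_nat prime_gt0. Qed.

Lemma scale_inj : injective (scale l).
Proof.
move=> [[a b] c] [[a' b'] c'] [/(mulfI l_neq0) -> /(mulfI l_neq0) -> /(mulfI l_neq0) ->].
by [].
Qed.

Lemma sphere_vec0mod n :
  perm_eq [seq v <- sphere (l ^ 2 * n) | vec0mod l v] [seq scale l v | v <- sphere n].
Proof.
apply: uniq_perm; first by rewrite filter_uniq ?sphere_uniq.
  by rewrite (map_inj_uniq scale_inj) sphere_uniq.
move=> x; rewrite mem_filter mem_sphere; apply/andP/mapP.
  case=> /vec0modP[y ->]; rewrite dot_scale => h; exists y => //.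
  rewrite mem_sphere; apply/eqP; apply: (mulfI (expf_neq0 2 l_neq0)).
  by rewrite (eqP h) PoszM.
case=> y; rewrite mem_sphere => /eqP hy ->; split; first by apply/vec0modP; exists y.
by rewrite dot_scale hy PoszM.
Qed.

Lemma count_vec0mod n : count (vec0mod l) (sphere n) = r3_div n.
Proof.
rewrite /r3_div; case: ifP => [/dvdnP[m ->]|hn].
  by rewrite mulnK // mulnC -size_filter (perm_size (sphere_vec0mod m)) size_map.
apply/eqP; rewrite -leqn0 leqNgt -has_count; apply/hasPn => v.
rewrite mem_sphere => /eqP hv; apply/vec0modP => -[y hy].
move: hv; rewrite hy dot_scale => hv.
suff : (l%:Z ^+ 2 %| n%:Z)%Z by rewrite dvdzE abszX /= hn.
by rewrite -hv dvdz_mulr.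
Qed.

(** As [dot x x] vanishes modulo [l], the symbol in the count of orthogonal lines is 0. *)
Lemma card_nbhd_isoline a b n x : (l%:Z ^+ 2 %| a ^+ 2 + b ^+ 2 + 1)%Z ->
  x \in sphere (l ^ 2 * n) -> ~~ vec0mod l x ->
  #|[pred t | nbhd l (isoline a b t) x]| = 1%N.
Proof.
move=> ab; rewrite mem_sphere => /eqP xx x0.
have xx2 : (l%:Z ^+ 2 %| dot x x)%Z by rewrite xx PoszM dvdz_mulr.
have -> : #|[pred t | nbhd l (isoline a b t) x]| =
  #|[pred t | (l %| dot x (isoline a b t))%Z]|.
  by apply: eq_card => t; rewrite !inE dot_mod_sqr.
apply/eqP; rewrite -eqz_nat card_isoline_orthogonal // (negbTE x0) /legendre.
by rewrite rpredN (dvdz_trans _ xx2) // expr2 dvdz_mulr.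
Qed.

Lemma card_nbhd_scale a b y :
  #|[pred t | nbhd l (isoline a b t) (scale l y)]| =
  #|[pred t | (l %| dot y (isoline a b t))%Z]|.
Proof.
apply: eq_card => t; rewrite !inE; move: (isoline a b t) => v.
have dl : dot (scale l y) v = l%:Z * dot y v by rewrite /scale; vsimp; ring.
rewrite /nbhd dl expr2 dvdz_mul2l // /scale /=.
by rewrite -!mulrA -!mulrBr !dvdz_mulr.
Qed.

Lemma r3_hecke n :
  (r3 (l ^ 2 * n))%:Z + legendre (- n%:Z) l * r3 n + l%:Z * r3_div n = (1 + l%:Z) * r3 n.
Proof.
have [a [b ab]] := sum_two_squares_m1_mod_sqr.
(* Incidences of lines and vectors, counted here by lines and next by vectors. *)
have tot : (\sum_(t : option 'F_l) count (nbhd l (isoline a b t)) (sphere (l ^ 2 * n)) =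
   l.+1 * r3 n)%N.
  rewrite (eq_bigr (fun=> r3 n)).
    by rewrite sum_nat_const card_option card_Fp.
  by move=> t _; rewrite count_nbhd ?isoline_dot ?isoline_neq0.
have : (\sum_(x <- sphere (l ^ 2 * n)) #|[pred t | nbhd l (isoline a b t) x]|)%N = (l.+1 * r3 n)%N.
  rewrite -tot; under [RHS]eq_bigr do rewrite -sum1_count.
  under eq_bigr do rewrite -sum1_card.
  by rewrite (exchange_big_dep xpredT).
rewrite (bigID (vec0mod l)) /= -big_filter (perm_big _ (sphere_vec0mod n)) big_map.
under eq_bigr do rewrite card_nbhd_scale.
have := count_predC (vec0mod l) (sphere (l ^ 2 * n)).
rewrite count_vec0mod /r3_div dvdn_mulr // mulKn // -!/(r3 _).
have -> : (\sum_(x <- sphere (l ^ 2 * n) | ~~ vec0mod l x)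
     #|[pred t | nbhd l (isoline a b t) x]|)%N = count (predC (vec0mod l)) (sphere (l ^ 2 * n)).
  rewrite -sum1_count big_seq_cond [RHS]big_seq_cond; apply: eq_bigr => x /andP[xs x0].
  exact: card_nbhd_isoline ab xs x0.
have : (\sum_(y <- sphere n) #|[pred t | (l %| dot y (isoline a b t))%Z]|)%N%:Z =
  (r3 n)%:Z * (1 + legendre (- n%:Z) l) + (r3_div n)%:Z * (l%:Z - legendre (- n%:Z) l).
  rewrite (big_morph Posz PoszD (erefl _)).
  have E y : y \in sphere n -> #|[pred t | (l %| dot y (isoline a b t))%Z]|%:Z =
     (1 + legendre (- n%:Z) l) + (vec0mod l y)%:Z * (l%:Z - legendre (- n%:Z) l).
    rewrite mem_sphere => /eqP yn; rewrite card_isoline_orthogonal // yn.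
    by case: (vec0mod l y); rewrite ?mul0r ?addr0 // mul1r -addn1 PoszD; ring.
  rewrite (eq_big_seq _ E) big_split /= -mulr_suml big_const_seq iter_addr_0.
  rewrite count_predT -[_ *+ size _]mulr_natl natz; congr (_ + _ * _).
  by rewrite -(big_morph Posz PoszD (erefl _)) -count_vec0mod -sumn_count sumnE big_map.
(* [r3_div n] is nonzero only if [l] divides [n], and then the symbol is 0. *)
have q0 : (r3_div n)%:Z * legendre (- n%:Z) l = 0.
  rewrite /r3_div; case: ifP => [h|]; last by rewrite mul0r.
  rewrite /legendre rpredN (_ : (l %| n%:Z)%Z) ?mulr0 //.
  by apply: dvdn_trans h; rewrite expnS dvdn_mulr.
rewrite mulrBr q0 subr0; move: q0.
rewrite -/(r3_div n); move: (count _ _) (\sum_(_ <- _) _)%N => A B.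
move=> _ EB EA ES.
have : ((B + A)%N : int) = (l.+1 * r3 n)%N by rewrite ES.
rewrite PoszD PoszM EB -EA PoszD -addn1 PoszD => ET.
move: ET; move: (legendre _ _) (r3 n)%:Z (r3_div n)%:Z A%:Z (l%:Z) => c r q x y ET.
have -> : x = (y + 1) * r - (r * (1 + c) + q * y) by rewrite -ET; ring.
by ring.
Qed.

End Hecke.

(** * Theta series *)

Definition pos_square (n : nat) : bool :=
  (0 < n)%N && [exists m : 'I_n.+1, (m ^ 2 == n)%N].

Lemma pos_squareP n : reflect (exists2 m, (0 < m)%N & n = (m ^ 2)%N) (pos_square n).
Proof.
apply: (iffP andP) => [[n0 /existsP[m /eqP mn]]|[m m0 ->]].
  by exists m => //; rewrite lt0n; apply: contraTneq n0 => m0; rewrite -mn m0.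
split; first by rewrite expn_gt0 m0.
have lt : (m < (m ^ 2).+1)%N by rewrite ltnS expnS leq_pmulr // expn_gt0 m0.
by apply/existsP; exists (Ordinal lt) => /=.
Qed.

Lemma coef_square_poly N n : (n <= N)%N -> (square_poly N)`_n = (pos_square n)%:Z.
Proof.
move=> nN; rewrite /square_poly coef_sum big_mkord.
under eq_bigr do rewrite coefXn.
case: pos_squareP => [[m m0 nm]|h].
  have mN : (m.-1 < N)%N by move: (leq_trans nN (leqnn _)); rewrite nm; nia.
  rewrite (bigD1 (Ordinal mN)) //= prednK // nm eqxx big1 ?addr0 // => i /eqP hi.
  case: eqP => // E; case: hi; apply: val_inj => /=.
  have /eqP := E; rewrite eqn_exp2r // => /eqP ->; lia.
rewrite big1 // => i _; case: eqP => // E; case: h; exists i.+1 => //.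
Qed.

Lemma square_poly_zrange N :
  1 + 2 * square_poly N = \sum_(x <- zrange N) 'X^(`|x| ^ 2).
Proof.
have -> : zrange N = [seq - (i.+1%:Z) | i <- rev (iota 0 N)] ++ [seq i%:Z | i <- iota 0 N.+1].
  apply: (@eq_from_nth _ 0).
    by rewrite size_cat !size_map size_rev !size_iota; lia.
  move=> i; rewrite size_map size_iota => hi.
  rewrite (nth_map 0%N) ?size_iota // nth_iota // nth_cat size_map size_rev size_iota.
  case: ltnP => iN.
    rewrite (nth_map 0%N) ?size_rev ?size_iota // nth_rev ?size_iota // nth_iota; lia.
  rewrite (nth_map 0%N) ?size_iota ?nth_iota; lia.
rewrite big_cat !big_map /= big_cons.
have -> : \sum_(j <- rev (iota 0 N)) 'X^(`|- j.+1%:Z| ^ 2) = square_poly N.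
  rewrite /square_poly (perm_big (iota 0 N)) ?perm_rev //= /index_iota subn0.
  by apply: eq_bigr => j _; congr ('X^_); lia.
rewrite (iotaDl 1 0) big_map /square_poly /index_iota subn0 expr0.
by rewrite mulr_natl mulr2n addrCA; congr (_ + (_ + _)).
Qed.

Lemma coef_theta_cube N n : (n <= N)%N -> ((1 + 2 * square_poly N) ^+ 3)`_n = (r3 n)%:Z.
Proof.
move=> nN; rewrite square_poly_zrange.
have -> : (\sum_(x <- zrange N) 'X^(`|x| ^ 2) : {poly int}) ^+ 3 =
   \sum_(v <- box N) 'X^(`|dot v v|).
  rewrite /box !big_allpairs_dep /= !exprS expr0 mulr1 mulr_suml.
  apply: eq_bigr => x _; rewrite mulr_suml mulr_sumr; apply: eq_bigr => y _.
  rewrite !mulr_sumr; apply: eq_bigr => z _.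
  rewrite -!exprD; congr ('X^_); vsimp; lia.
rewrite coef_sum /r3.
under eq_bigr do rewrite coefXn.
have -> : \sum_(v <- box N) (n == `|dot v v|%N)%:R = (size [seq v <- box N | dot v v == n%:Z])%:Z.
  rewrite size_filter -sumn_count sumnE big_map (big_morph Posz PoszD (erefl _)).
  apply: eq_bigr => v _; rewrite natz; congr (Posz (nat_of_bool _)).
  by have := dot_ge0 v; lia.
congr Posz; apply/perm_size/uniq_perm; rewrite ?filter_uniq ?box_uniq //.
move=> v; rewrite mem_sphere mem_filter andb_idr // => /eqP hv; rewrite mem_box.
by move: hv; case: v => [[x y] z]; vsimp => h; apply/and3P; split; nia.
Qed.

(** * Sums of two squares *)

Definition pbox (n : nat) : seq (int * int) := [seq (x, y) | x <- zrange n, y <- zrange n].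

Definition circle (n : nat) : seq (int * int) :=
  [seq w <- pbox n | w.1 ^+ 2 + w.2 ^+ 2 == n%:Z].

Lemma mem_pbox n w : (w \in pbox n) = (`|w.1| <= n%:Z) && (`|w.2| <= n%:Z).
Proof.
case: w => x y /=; rewrite -!mem_zrange.
apply/allpairsP/andP => [[[x' y'] [hx hy [-> ->]]]|[hx hy]] //.
by exists (x, y).
Qed.

Lemma pbox_uniq n : uniq (pbox n).
Proof. by rewrite allpairs_uniq ?zrange_uniq // => -[? ?] [? ?] _ _ [-> ->]. Qed.

Lemma circle_uniq n : uniq (circle n). Proof. by rewrite filter_uniq ?pbox_uniq. Qed.

Lemma mem_circle n w : (w \in circle n) = (w.1 ^+ 2 + w.2 ^+ 2 == n%:Z).
Proof.
rewrite mem_filter andb_idr // => /eqP hv; rewrite mem_pbox.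
by move: hv; case: w => x y /= h; apply/andP; split; nia.
Qed.

(** The map [f] doubles the norm, and it is onto because an even [x^2 + y^2] forces [x] and [y] to
    have the same parity. *)
Lemma size_circle_double n : size (circle n.*2) = size (circle n).
Proof.
pose f (w : int * int) := (w.1 + w.2, w.1 - w.2).
have finj : injective f by move=> [x y] [x' y'] [h1 h2]; congr (_, _); lia.
rewrite -(size_map f (circle n)); apply/perm_size/uniq_perm.
- exact: circle_uniq.
- by rewrite (map_inj_uniq finj) circle_uniq.
move=> [x y]; rewrite mem_circle /=; apply/eqP/mapP => [h|[[u v]]]; last first.
  rewrite mem_circle /= => /eqP h [-> ->]; rewrite -addnn PoszD -h; ring.
have [u hu] : exists u, x + y = 2 * u.
  exists ((x + y) %/ 2)%Z; have : (2 %| x + y)%Z; last by lia.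
  have : (2 %| (x + y) ^+ 2)%Z.
    apply/dvdzP; exists (n%:Z + x * y); rewrite -addnn PoszD in h.
    by rewrite sqrrD mulr2n; lia.
  by rewrite !dvdzE abszX Euclid_dvdX // andbT.
exists (u, x - u); last by rewrite /f /=; congr (_, _); lia.
rewrite mem_circle /=; apply/eqP; rewrite -addnn PoszD in h.
have E : (x + y) ^+ 2 + (2 * x - (x + y)) ^+ 2 = 2 * (n%:Z + n%:Z) by rewrite -h; ring.
by rewrite hu in E; move: E; rewrite -mulrBr !exprMn; lia.
Qed.

Lemma coef_theta_sqr N n : (n <= N)%N -> ((1 + 2 * square_poly N) ^+ 2)`_n = (size (circle n))%:Z.
Proof.
move=> nN; rewrite square_poly_zrange.
have -> : (\sum_(x <- zrange N) 'X^(`|x| ^ 2) : {poly int}) ^+ 2 =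
   \sum_(w <- pbox N) 'X^(`|w.1 ^+ 2 + w.2 ^+ 2|).
  rewrite /pbox big_allpairs_dep /= expr2 mulr_suml.
  apply: eq_bigr => x _; rewrite mulr_sumr; apply: eq_bigr => y _.
  rewrite -!exprD; congr ('X^_); lia.
rewrite coef_sum.
under eq_bigr do rewrite coefXn.
have -> : \sum_(w <- pbox N) (n == `|(w.1 ^+ 2 + w.2 ^+ 2)%R|%N)%:R =
    (size [seq w <- pbox N | w.1 ^+ 2 + w.2 ^+ 2 == n%:Z])%:Z.
  rewrite size_filter -sumn_count sumnE big_map (big_morph Posz PoszD (erefl _)).
  apply: eq_bigr => v _; rewrite natz; congr (Posz (nat_of_bool _)).
  by move: (sqr_ge0 v.1) (sqr_ge0 v.2); move: (v.1 ^+ 2) (v.2 ^+ 2) => a b; lia.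
congr Posz; apply/perm_size/uniq_perm; rewrite ?filter_uniq ?pbox_uniq //.
move=> w; rewrite mem_circle mem_filter andb_idr // => /eqP hv; rewrite mem_pbox.
by move: hv; case: w => x y /= h; apply/andP; split; nia.
Qed.

(** * Gradings by residue classes and squaring modulo 2 *)

Definition supp_mod (N m r : nat) (p : {poly int}) :=
  forall i, (i <= N)%N -> (i != r %[mod m])%N -> p`_i = 0.

Lemma supp_modM N m r s p q :
  supp_mod N m r p -> supp_mod N m s q -> supp_mod N m (r + s) (p * q).
Proof.
move=> hp hq i iN hi; rewrite coefM big1 // => j _.
have ji : (j <= i)%N by rewrite -ltnS.
have [jr|jr] := eqVneq (j %% m)%N (r %% m)%N; last by rewrite hp ?mul0r ?(leq_trans ji).
rewrite hq ?mulr0 ?(leq_trans (leq_subr _ _)) //.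
apply: contraNneq hi => hs.
by rewrite -(subnKC ji) -modnDm jr hs modnDm.
Qed.

Lemma supp_modZ N m r (c : int) p : supp_mod N m r p -> supp_mod N m r (c%:P * p).
Proof. by move=> hp i iN hi; rewrite coefCM hp ?mulr0. Qed.

Lemma supp_mod1D N m p : supp_mod N m 0 p -> supp_mod N m 0 (1 + p).
Proof.
move=> hp i iN hi; rewrite coefD hp // coef1 addr0.
by case: i hi {iN} => //; rewrite eqxx.
Qed.

Lemma supp_mod_dvd N m k r p : (k %| m)%N -> supp_mod N m r p -> supp_mod N k r p.
Proof.
move=> km hp i iN hi; apply: hp => //; apply: contraNneq hi => h.
by rewrite -(modn_dvdm i km) h modn_dvdm.
Qed.

(** The Frobenius congruence modulo 2, kept as an identity over the integers so that it can be
    squared again for congruences modulo 4 and 8. *)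
Lemma sqr_poly_mod2 (p : {poly int}) : exists u, p ^+ 2 = p \Po 'X^2 + 2 * u.
Proof.
elim/poly_ind: p => [|p c [u hu]]; first by exists 0; rewrite comp_poly0; ring.
have [d hd] : exists d : int, c ^+ 2 = c + 2 * d.
  exists ((c ^+ 2 - c) %/ 2)%Z.
  have [k [->|->]] : exists k : int, c = 2 * k \/ c = 2 * k + 1.
    by exists (c %/ 2)%Z; lia.
  - have -> : (2 * k) ^+ 2 - 2 * k = 2 * (2 * k ^+ 2 - k) by ring.
    by rewrite mulKz //; ring.
  - have -> : (2 * k + 1) ^+ 2 - (2 * k + 1) = 2 * (2 * k ^+ 2 + k) by ring.
    by rewrite mulKz //; ring.
exists (u * 'X^2 + p * 'X * c%:P + d%:P).
rewrite comp_polyD comp_polyM comp_polyX comp_polyC.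
have hdP : c%:P ^+ 2 = c%:P + 2 * d%:P :> {poly int}.
  by rewrite -rmorphXn hd rmorphD rmorphM /= -polyC_natr.
transitivity (p ^+ 2 * 'X^2 + 2 * (p * 'X * c%:P) + c%:P ^+ 2); first by ring.
by rewrite hu hdP; ring.
Qed.

Lemma pos_square_mul4 i : pos_square (4 * i) = pos_square i.
Proof.
apply/pos_squareP/pos_squareP => -[m m0 hm]; last by exists (2 * m)%N; lia.
have m2 : ~~ odd m.
  by have := congr1 odd hm; rewrite oddM oddX /= => <-.
exists m./2; first by lia.
by move: hm; rewrite -{1}(even_halfK m2) -mul2n expnMn; lia.
Qed.

Lemma pos_square_mod8 i : pos_square i -> ~~ (4 %| i)%N -> (i %% 8 = 1)%N.
Proof.
case/pos_squareP=> m m0 ->; have [k [->|->]] : exists k, m = (2 * k)%N \/ m = (2 * k + 1)%N.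
- by exists m./2; lia.
- by rewrite expnMn dvdn_mulr.
move=> _; have e : ~~ odd (k * k.+1) by rewrite oddM /=; case: (odd k).
have -> : ((2 * k + 1) ^ 2 = 4 * (k * k.+1) + 1)%N by lia.
by move: (k * k.+1)%N e => e; lia.
Qed.

Section SquarePoly.

Variable N : nat.

Let T := square_poly N.
Let V := T \Po 'X^2.
(** The even squares are the [4 m^2], so up to degree [N] this is the part of [T] with exponents
    divisible by 4; [To] carries the odd squares, all 1 modulo 8. *)
Let Te := T \Po 'X^4.
Let To := T - Te.

Lemma supp_even : supp_mod N 4 0 Te.
Proof.
move=> i iN; rewrite mod0n => hi; rewrite coef_comp_poly_Xn //.
by rewrite /dvdn (negbTE hi).
Qed.

Lemma supp_odd : supp_mod N 8 1 To.
Proof.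
move=> i iN hi; rewrite coefB coef_comp_poly_Xn // coef_square_poly //.
case: ifP => [/dvdnP[j ij]|h4].
  rewrite coef_square_poly; last by rewrite ij mulnK //; lia.
  by rewrite ij mulnK // mulnC pos_square_mul4 subrr.
rewrite subr0; case: (boolP (pos_square i)) => // /pos_square_mod8; rewrite h4 => /(_ isT) h.
by rewrite h in hi.
Qed.

Let TE : T = Te + To. Proof. by rewrite /To addrC subrK. Qed.

Let A := 1 + 2%:P * Te.
Let B := 2%:P * To.

Let supp_A : supp_mod N 4 0 A.
Proof. exact/supp_mod1D/supp_modZ/supp_even. Qed.

Let supp_B8 : supp_mod N 8 1 B. Proof. exact/supp_modZ/supp_odd. Qed.

Let supp_B : supp_mod N 4 1 B. Proof. exact: supp_mod_dvd supp_B8. Qed.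

Let thetaE : 1 + 2 * T = A + B.
Proof. by rewrite /A /B TE -polyC_natr; ring. Qed.

Let W := (1 + 2 * V) ^+ 2.

Let WE : W = (1 + 2 * T) ^+ 2 \Po 'X^2.
Proof. by rewrite rmorphXn rmorphD rmorphM rmorph1 rmorph_nat. Qed.

(* (x, y) -> (x + y, x - y) maps Z^2 onto the pairs of equal parity. *)
Lemma theta_sqr_even i : (i <= N)%N -> W`_i = (A ^+ 2 + B ^+ 2)`_i.
Proof.
move=> iN; rewrite WE coef_comp_poly_Xn // coefD ![in RHS]expr2.
case: ifP => [/dvdnP[j ij]|h2]; last first.
  rewrite (supp_modM supp_A supp_A) // ?(supp_modM supp_B supp_B) ?addr0 //.
  - by apply: contraFneq h2; lia.
  - by apply: contraFneq h2; lia.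
rewrite ij mulnK // (@coef_theta_sqr N); last by lia.
rewrite -size_circle_double -muln2 -(@coef_theta_sqr N) -?ij // -/T thetaE.
have -> : (A + B) ^+ 2 = A * A + B * B + 2%:P * (A * B) by rewrite polyC_natr; ring.
rewrite coefD coefD coefCM (supp_modM supp_A supp_B) ?mulr0 ?addr0 //.
by rewrite ij; lia.
Qed.

Lemma eq_upto_W : eq_upto N W (A ^+ 2 + B ^+ 2).
Proof. exact: theta_sqr_even. Qed.

(* For odd n, the numbers of representations of n by x^2 + 2 y^2 + 2 z^2 and x^2 + y^2 + 2 z^2. *)
Definition r122 n := ((1 + 2 * T) * W)`_n.
Definition r112 n := ((1 + 2 * T) ^+ 2 * (1 + 2 * V))`_n.

Let suppAAA : supp_mod N 4 0 (A * A * A).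
Proof. exact (supp_modM (supp_modM supp_A supp_A) supp_A). Qed.
Let suppAAB : supp_mod N 4 1 (A * A * B).
Proof. exact (supp_modM (supp_modM supp_A supp_A) supp_B). Qed.
Let suppABB : supp_mod N 4 2 (A * B * B).
Proof. exact (supp_modM (supp_modM supp_A supp_B) supp_B). Qed.
Let suppBBB : supp_mod N 4 3 (B * B * B).
Proof. exact (supp_modM (supp_modM supp_B supp_B) supp_B). Qed.

Let cubeE : (1 + 2 * T) ^+ 3 = A * A * A + 3%:P * (A * A * B) + 3%:P * (A * B * B) + B * B * B.
Proof. by rewrite thetaE !polyC_natr; ring. Qed.

Let r122E n : (n <= N)%N ->
  r122 n = (A * A * A + A * A * B + A * B * B + B * B * B)`_n.
Proof.
move=> nN; rewrite /r122 (eq_uptoM (@eq_upto_refl N _) eq_upto_W) // thetaE.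
have -> // : (A + B) * (A ^+ 2 + B ^+ 2) = A * A * A + A * A * B + A * B * B + B * B * B.
by ring.
Qed.

(** Exactly one of the three squares is odd: it has three places in [r3], but only the first in
    [r122]. *)
Lemma r3_r122_1 n : (n <= N)%N -> (n %% 4 = 1)%N -> (r3 n)%:Z = 3 * r122 n.
Proof.
move=> nN n4; rewrite -(coef_theta_cube nN) -/T cubeE r122E // !coefD !coefCM.
by rewrite (suppAAA nN) 1?(suppABB nN) 1?(suppBBB nN) ?n4 //; ring.
Qed.

(** Here all three squares are odd, and the term [B * B * B] occurs once on both sides. *)
Lemma r3_r122_3 n : (n <= N)%N -> (n %% 4 = 3)%N -> (r3 n)%:Z = r122 n.
Proof.
move=> nN n4; rewrite -(coef_theta_cube nN) -/T cubeE r122E // !coefD !coefCM.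
by rewrite (suppAAA nN) 1?(suppABB nN) 1?(suppAAB nN) ?n4 //; ring.
Qed.

(** Substituting ['X^2] turns the series of [r112] into [W * A]. As [2 * n] is 2 modulo 4, exactly
    one of the three squares is even, with three possible places in [r3]. *)
Lemma r3_r112 n : (2 * n <= N)%N -> odd n -> (r3 (2 * n))%:Z = 3 * r112 n.
Proof.
move=> nN no.
have n4 : (2 * n %% 4 = 2)%N by lia.
rewrite -(coef_theta_cube nN) -/T cubeE !coefD !coefCM.
have -> : r112 n = (W * A)`_(2 * n).
  have -> : W * A = ((1 + 2 * T) ^+ 2 * (1 + 2 * V)) \Po 'X^2.
    rewrite [RHS]rmorphM WE; congr (_ * _).
    rewrite rmorphD rmorphM rmorph1 rmorph_nat /A polyC_natr; congr (_ + _ * _).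
    by rewrite /= -comp_polyA comp_Xn_poly -exprM.
  by rewrite coef_comp_poly_Xn // dvdn_mulr // mulKn.
rewrite (eq_uptoM eq_upto_W (@eq_upto_refl N _)) //.
have -> : (A ^+ 2 + B ^+ 2) * A = A * A * A + A * B * B by ring.
rewrite coefD.
by rewrite (suppAAA nN) 1?(suppAAB nN) 1?(suppBBB nN) ?n4 //; ring.
Qed.

End SquarePoly.

(** * Overpartitions modulo powers of two *)

Definition signed_pbar (n : nat) : int := (-1) ^+ n * (pbar n)%:Z.

Section Coefficients.

Variables (N n : nat).
Hypothesis nN : (n <= N)%N.

Let T := square_poly N.
Let V := T \Po 'X^2.
Let Te := T \Po 'X^4.
Let To := T - Te.

(** Truncated geometric series for [1 / (1 + 2 T)]: [S * (1 + 2 T) = 1 + 128 T^7], so the remainder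
    is an exact multiple of 128. *)
Lemma signed_pbar_expand : (0 < n)%N -> exists z,
  signed_pbar n = - 2 * T`_n + 4 * (T ^+ 2)`_n - 8 * (T ^+ 3)`_n + 16 * (T ^+ 4)`_n
    - 32 * (T ^+ 5)`_n + 64 * (T ^+ 6)`_n + 128 * z.
Proof.
move=> n0; set P := signed_pbar_poly N.
pose S := 1 + (- 2)%:P * T + 4%:P * T ^+ 2 + (- 8)%:P * T ^+ 3 + 16%:P * T ^+ 4
    + (- 32)%:P * T ^+ 5 + 64%:P * T ^+ 6.
have h : eq_upto N (P + 128%:P * (T ^+ 7 * P)) S.
  have -> : P + 128%:P * (T ^+ 7 * P) = S * ((1 + 2 * T) * P).
    by rewrite /S !rmorphN /= !polyC_natr; ring.
  rewrite -[X in eq_upto _ _ X]mulr1.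
  exact: (eq_uptoM (@eq_upto_refl N _) (@theta_signed_pbar N)).
exists (- (T ^+ 7 * P)`_n).
have := h n nN; rewrite /S !coefD !coefCM coef1 (gtn_eqF n0) coef_poly ltnS nN.
by rewrite natz -/(signed_pbar n) => E; rewrite -[LHS](addrK (128 * (T ^+ 7 * P)`_n)) E /=; ring.
Qed.

Lemma r3_expand : (0 < n)%N ->
  (r3 n)%:Z = 6 * T`_n + 12 * (T ^+ 2)`_n + 8 * (T ^+ 3)`_n.
Proof.
move=> n0; rewrite -(coef_theta_cube nN) -/T.
have -> : (1 + 2 * T) ^+ 3 = 1 + 6%:P * T + 12%:P * T ^+ 2 + 8%:P * T ^+ 3.
  by rewrite !polyC_natr; ring.
by rewrite !coefD !coefCM coef1 (gtn_eqF n0) add0r.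
Qed.

Lemma coef_comp_X2_odd (p : {poly int}) : odd n -> (p \Po 'X^2)`_n = 0.
Proof. by move=> no; rewrite coef_comp_poly_Xn // dvdn2 no. Qed.

Let V2E : V ^+ 2 = T ^+ 2 \Po 'X^2.
Proof. by rewrite rmorphXn. Qed.

Lemma r112_expand : odd n -> r112 N n =
  4 * T`_n + 4 * (T ^+ 2)`_n + 8 * (T * V)`_n + 8 * (T ^+ 2 * V)`_n.
Proof.
move=> no; rewrite /r112 -/T -/V.
have -> : (1 + 2 * T) ^+ 2 * (1 + 2 * V) = 1 + 4%:P * T + 4%:P * T ^+ 2 + 8%:P * (T * V)
   + 8%:P * (T ^+ 2 * V) + 2%:P * V by rewrite !polyC_natr; ring.
rewrite !coefD !coefCM coef1 [V`_n]coef_comp_X2_odd // gtn_eqF ?odd_gt0 //.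
by rewrite add0r addr0.
Qed.

Lemma r122_expand : odd n -> r122 N n =
  2 * T`_n + 8 * (T * V)`_n + 8 * (T * V ^+ 2)`_n.
Proof.
move=> no; rewrite /r122 -/T -/V.
have -> : (1 + 2 * T) * (1 + 2 * V) ^+ 2 = 1 + 2%:P * T + 8%:P * (T * V)
   + 8%:P * (T * V ^+ 2) + 4%:P * V + 4%:P * V ^+ 2 by rewrite !polyC_natr; ring.
rewrite !coefD !coefCM coef1 [V`_n]coef_comp_X2_odd // gtn_eqF ?odd_gt0 //.
by rewrite V2E coef_comp_X2_odd // add0r !addr0.
Qed.

Lemma sqr_coef_even : odd n -> exists z, (T ^+ 2)`_n = 2 * z.
Proof.
move=> no; have [u ->] := sqr_poly_mod2 T; exists u`_n.
by rewrite -polyC_natr coefD coefCM coef_comp_X2_odd // add0r.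
Qed.

Let TE : T = Te + To. Proof. by rewrite /To addrC subrK. Qed.

Let supp_To : supp_mod N 4 1 To.
Proof. by apply: (@supp_mod_dvd _ 8); last exact: supp_odd. Qed.

Let supp_Te : supp_mod N 4 0 Te. Proof. exact: supp_even. Qed.

Lemma sqr_coef_mod4 : (n %% 4 = 3)%N -> (T ^+ 2)`_n = 0.
Proof.
move=> n4; have -> : T ^+ 2 = Te * Te + 2%:P * (Te * To) + To * To.
  by rewrite TE polyC_natr; ring.
rewrite !coefD coefCM (supp_modM supp_Te supp_Te) ?(supp_modM supp_Te supp_To)
  ?(supp_modM supp_To supp_To) ?n4 //.
Qed.

Lemma T_Te_mod4 : (1 < n %% 4)%N -> (T * Te)`_n = 0.
Proof.
move=> n4; rewrite TE mulrDl coefD mulrC [To * _]mulrC.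
rewrite (supp_modM supp_Te supp_Te) ?(supp_modM supp_Te supp_To) //;
  by case: (n %% 4)%N n4 => [|[|?]].
Qed.

(** Modulo 2, [V ^+ 2] is [Te], and [T * Te] lives in degrees 0 and 1 modulo 4. *)
Lemma TV2_even : (1 < n %% 4)%N -> exists z, (T * V ^+ 2)`_n = 2 * z.
Proof.
move=> n4; have [u hu] := sqr_poly_mod2 T.
exists (T * (u \Po 'X^2))`_n.
have -> : V ^+ 2 = Te + 2 * (u \Po 'X^2).
  rewrite V2E hu rmorphD rmorphM rmorph_nat /= -comp_polyA comp_Xn_poly -exprM //.
rewrite mulrDr -polyC_natr mulrCA coefD coefCM T_Te_mod4 // add0r //.
Qed.

(** Squaring [T^2 = V + 2 u] and eliminating [u V] gives [T^4 = 2 T^2 V - V^2 + 4 u^2]. Both [V^2]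
    and, modulo 2, [u^2] are series in ['X^2], invisible at odd [n]. *)
Lemma T4_odd : odd n -> exists z, (T ^+ 4)`_n = 2 * (T ^+ 2 * V)`_n + 8 * z.
Proof.
move=> no; have [u hu] := sqr_poly_mod2 T; have [w hw] := sqr_poly_mod2 u.
exists w`_n.
have -> : T ^+ 4 = 2%:P * (T ^+ 2 * V) + 8%:P * w + 4%:P * (u \Po 'X^2) - V ^+ 2.
  rewrite (_ : T ^+ 4 = (T ^+ 2) ^+ 2); last by ring.
  rewrite hu -/V; have -> : (V + 2 * u) ^+ 2 = V ^+ 2 + 4 * V * u + 4 * u ^+ 2 by ring.
  by rewrite hw !polyC_natr; ring.
rewrite !coefD coefN !coefCM V2E !coef_comp_X2_odd // mulr0 subr0 addr0 //.
Qed.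

Lemma T2V_even : odd n -> exists z, (T ^+ 2 * V)`_n = 2 * z.
Proof.
move=> no; have [u hu] := sqr_poly_mod2 T.
exists (u * V)`_n.
have -> : T ^+ 2 * V = V ^+ 2 + 2%:P * (u * V) by rewrite hu polyC_natr -/V; ring.
by rewrite coefD coefCM V2E coef_comp_X2_odd // add0r.
Qed.

Lemma T5_mod4 : exists z, (T ^+ 5)`_n = (T * V ^+ 2)`_n + 4 * z.
Proof.
have [u hu] := sqr_poly_mod2 T.
exists (T * (V * u + u ^+ 2))`_n.
have -> : T ^+ 5 = T * V ^+ 2 + 4%:P * (T * (V * u + u ^+ 2)).
  rewrite (_ : T ^+ 5 = T * (T ^+ 2) ^+ 2); last by ring.
  by rewrite hu -/V polyC_natr; ring.
by rewrite coefD coefCM.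
Qed.

Lemma T6_even : odd n -> exists z, (T ^+ 6)`_n = 2 * z.
Proof.
move=> no; have [u hu] := sqr_poly_mod2 (T ^+ 3); exists u`_n.
have -> : T ^+ 6 = (T ^+ 3) \Po 'X^2 + 2%:P * u by rewrite polyC_natr -hu; ring.
by rewrite coefD coefCM coef_comp_X2_odd // add0r.
Qed.

Lemma T4_even m : n = (2 * m)%N -> exists z, (T ^+ 4)`_n = (T ^+ 2)`_m + 4 * z.
Proof.
move=> nm; have [u hu] := sqr_poly_mod2 T.
exists (V * u + u ^+ 2)`_n.
have -> : T ^+ 4 = V ^+ 2 + 4%:P * (V * u + u ^+ 2).
  rewrite (_ : T ^+ 4 = (T ^+ 2) ^+ 2); last by ring.
  by rewrite hu -/V polyC_natr; ring.
by rewrite coefD coefCM V2E coef_comp_poly_Xn // nm dvdn_mulr // mulKn.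
Qed.

Lemma T2_even m : n = (2 * m)%N -> exists z, (T ^+ 2)`_n = T`_m + 2 * z.
Proof.
move=> nm; have [u ->] := sqr_poly_mod2 T.
by exists u`_n; rewrite -polyC_natr coefD coefCM coef_comp_poly_Xn // nm dvdn_mulr // mulKn.
Qed.

Lemma circle_expand m : n = (2 * m)%N -> (0 < n)%N ->
  T`_n + (T ^+ 2)`_n = T`_m + (T ^+ 2)`_m.
Proof.
move=> nm n0.
have E k : (0 < k)%N -> ((1 + 2 * T) ^+ 2)`_k = 4 * (T`_k + (T ^+ 2)`_k).
  move=> k0; have -> : (1 + 2 * T) ^+ 2 = 1 + 4%:P * (T + T ^+ 2) by rewrite polyC_natr; ring.
  by rewrite coefD coefCM coefD coef1 gtn_eqF // add0r.
have m0 : (0 < m)%N by lia.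
apply: (@mulfI _ 4) => //; rewrite -!E // !coef_theta_sqr ?nm; try by lia.
by rewrite mul2n size_circle_double.
Qed.

End Coefficients.

(** The sum of [- 2 T + 4 T^2 - 8 T^3] and the expansion [6 T + 12 T^2 + 8 T^3] of [r3] is
    [4 T + 16 T^2]. *)
Lemma signed_pbar_mod16 n : (0 < n)%N ->
  exists z, signed_pbar n = 4 * (pos_square n)%:Z - (r3 n)%:Z + 16 * z.
Proof.
move=> n0; have [z ->] := signed_pbar_expand (leqnn n) n0.
rewrite (r3_expand (leqnn n) n0) -(coef_square_poly (leqnn n)).
set T := square_poly n.
exists ((T ^+ 2)`_n + (T ^+ 4)`_n - 2 * (T ^+ 5)`_n + 4 * (T ^+ 6)`_n + 8 * z).
by ring.
Qed.

Lemma r3_mod8 n : (0 < n)%N ->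
  exists z, n%:Z * (r3 n)%:Z = 6 * n%:Z * (pos_square n)%:Z + 8 * z.
Proof.
move=> n0; rewrite (r3_expand (leqnn n) n0) -(coef_square_poly (leqnn n)).
set T := square_poly n.
have [w hw] : exists w, n%:Z * (T ^+ 2)`_n = 2 * w.
  case: (boolP (odd n)) => no.
    by have [z ->] := sqr_coef_even n no; exists (n%:Z * z); ring.
  by exists ((n./2)%:Z * (T ^+ 2)`_n); rewrite -{1}(even_halfK no) -mul2n PoszM mulrA.
exists (3 * w + n%:Z * (T ^+ 3)`_n).
by rewrite !mulrDr [_ * (12 * _)]mulrCA hw; ring.
Qed.

(** With [a = r112] and [b = r122] the terms [T V] cancel in [4 a - 4 b], leaving the [T^2 V] and
    [T V^2] into which [T^4] and [T^5] collapse. These come with coefficient [n] on the left but 1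
    on the right; [n - 1] times their contribution vanishes modulo 128 by the evenness lemmas,
    differently for [n] = 1 and 3 modulo 4. *)
Lemma signed_pbar_odd n : odd n -> exists a b : int,
  [/\ (exists z, n%:Z * signed_pbar n = - n%:Z * (r3 n)%:Z + 4 * a - 4 * b
        + (4 * n%:Z - 8) * (pos_square n)%:Z + 128 * z),
      (r3 (2 * n))%:Z = 3 * a,
      (exists w, a = 4 * (pos_square n)%:Z + 8 * w) &
      (r3 n)%:Z = (if (n %% 4 == 1)%N then 3 else 1) * b].
Proof.
move=> no; have n0 : (0 < n)%N by rewrite odd_gt0.
pose N := (2 * n)%N; have nN : (n <= N)%N by rewrite leq_pmull.
have [z hz] := signed_pbar_expand nN n0.
exists (r112 N n), (r122 N n).
have [c2 h2] := sqr_coef_even N no.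
have [c4 h4] := T4_odd N no.
have [c5 h5] := T5_mod4 N n.
have [c6 h6] := T6_even N no.
have [d hd] := T2V_even N no.
have hr := r3_expand nN n0.
have ha := r112_expand N no; have hb := r122_expand N no.
rewrite (coef_square_poly nN) in hz hr ha hb.
split.
- set T := square_poly N in hz h2 h4 h5 h6 hd hr ha hb.
  have [n4|n4] : (n %% 4 = 1 \/ n %% 4 = 3)%N by lia.
  + have [j nj] : exists j, n = (4 * j + 1)%N by exists (n %/ 4)%N; lia.
    exists (n%:Z * (c4 - c5 + c6 + z) + j%:Z * c2 + 2 * j%:Z * d
      - j%:Z * (T * (T \Po 'X^2) ^+ 2)`_n).
    rewrite hz ha hb hr h4 h5 h6 hd h2.
    have -> : n%:Z = 4 * j%:Z + 1 by lia.
    by ring.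
  + have [j nj] : exists j, n = (4 * j + 3)%N by exists (n %/ 4)%N; lia.
    have [e he] : exists z, (T * (T \Po 'X^2) ^+ 2)`_n = 2 * z by apply: (TV2_even nN); rewrite n4.
    exists (n%:Z * (c4 - c5 + c6 + z) + (2 * j%:Z + 1) * (d - e)).
    have c20 : c2 = 0 by have := sqr_coef_mod4 nN n4; rewrite -/T h2; lia.
    rewrite hz ha hb hr h4 h5 h6 hd h2 he c20.
    have -> : n%:Z = 4 * j%:Z + 3 by lia.
    by ring.
- by apply: r3_r112.
- exists (c2 + (square_poly N * (square_poly N \Po 'X^2))`_n + 2 * d).
  by rewrite ha h2 hd; ring.
- case: eqP => n4; first exact: r3_r122_1.
  by rewrite mul1r; apply: r3_r122_3 => //; lia.
Qed.

Lemma pos_square_mod4 n : pos_square n -> (n %% 4 < 2)%N.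
Proof.
move=> sq; case: (boolP (4 %| n)%N) => h; first by lia.
by have := pos_square_mod8 sq h; lia.
Qed.

(** Collapsing [T^4] to degree [m] and using [circle_expand] for [T^2], their sum at [2 m] becomes
    that of [T + 2 T^2] at [m], up to multiples of 4; the coefficient of [T^2] at odd [m] is even.
    Odd squares being 1 modulo 8, the factor [m] drops out of the square term. *)
Lemma signed_pbar_2mod4 m : odd m -> exists z,
  (2 * m)%:Z * signed_pbar (2 * m) =
    - (2 * m)%:Z * (r3 (2 * m))%:Z + 32 * (pos_square m)%:Z + 128 * z.
Proof.
move=> mo; set n := (2 * m)%N; have n0 : (0 < n)%N by have := odd_gt0 mo; rewrite /n; lia.
have mn : (m <= n)%N by rewrite /n leq_pmull.
have n4 : (1 < n %% 4)%N by rewrite /n; lia.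
have sq0 : pos_square n = false.
  by apply: contraTF n4 => /pos_square_mod4; lia.
have [z hz] := signed_pbar_expand (leqnn n) n0.
have hr := r3_expand (leqnn n) n0.
have [z4 h4] := T4_even n (erefl : n = (2 * m)%N).
have [z5 h5] := T5_mod4 n n.
have [e he] := TV2_even (leqnn n) n4.
have [y hy] := sqr_coef_even n mo.
have hc := circle_expand (leqnn n) (erefl : n = (2 * m)%N) n0.
rewrite (coef_square_poly (leqnn n)) sq0 in hz hr hc.
rewrite (coef_square_poly mn) add0r hy in hc.
have [x hx] : exists x : int, (m%:Z - 1) * (pos_square m)%:Z = 4 * x.
  case: (boolP (pos_square m)) => sq; last by exists 0; rewrite mulr0.
  exists ((m %/ 8)%:Z * 2); have := pos_square_mod8 sq.
  have -> : ~~ (4 %| m)%N by lia.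
  by move/(_ isT); lia.
exists (x + m%:Z * y + m%:Z * z4 - m%:Z * e - 2 * m%:Z * z5 + m%:Z * (square_poly n ^+ 6)`_n
  + 2 * m%:Z * z).
rewrite hz hr h4 h5 he hy hc.
have -> : n%:Z = 2 * m%:Z by rewrite /n PoszM.
move: hx; move: (pos_square m)%:Z => s hx.
have -> : 128 * (x + m%:Z * y + m%:Z * z4 - m%:Z * e - 2 * m%:Z * z5
  + m%:Z * (square_poly n ^+ 6)`_n + 2 * m%:Z * z) = 32 * (4 * x) + 128 * ( m%:Z * y + m%:Z * z4
    - m%:Z * e - 2 * m%:Z * z5 + m%:Z * (square_poly n ^+ 6)`_n + 2 * m%:Z * z) by ring.
by rewrite -hx /=; ring.
Qed.

(** The factor [4 k] leaves only parities of the coefficients of [T^2] and [T^4]: those of [T] at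
    [2 k] and at [k]. The former drops out, since a square [2 k] makes [k] even; the latter adds 16
    to the coefficient 4 and yields 20. *)
Lemma signed_pbar_0mod4 k : (0 < k)%N -> exists z,
  (4 * k)%:Z * signed_pbar (4 * k) =
    - (4 * k)%:Z * (r3 (4 * k))%:Z + 20 * (4 * k)%:Z * (pos_square (4 * k))%:Z + 128 * z.
Proof.
move=> k0; set n := (4 * k)%N; have n0 : (0 < n)%N by rewrite /n muln_gt0.
have nE : n = (2 * (2 * k))%N by rewrite /n; lia.
have [z hz] := signed_pbar_expand (leqnn n) n0.
have hr := r3_expand (leqnn n) n0.
have [z4 h4] := T4_even n nE.
have [z2 h2] := T2_even n nE.
have [y hy] := T2_even n (erefl : (2 * k)%N = (2 * k)%N).
have sqk : (square_poly n)`_k = (pos_square n)%:Z.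
  by rewrite coef_square_poly ?pos_square_mul4 // leq_pmull.
rewrite (coef_square_poly (leqnn n)) in hz hr.
have h2k : (2 * k <= n)%N by rewrite /n; lia.
rewrite (coef_square_poly h2k) in h2.
rewrite sqk in hy.
have [x hx] : exists x : int, k%:Z * (pos_square (2 * k))%:Z = 2 * x.
  case: (boolP (pos_square (2 * k))) => sq; last by exists 0; rewrite mulr0.
  by exists (k %/ 2)%:Z; have := pos_square_mod4 sq; lia.
exists (x + k%:Z * (z2 + y + 2 * z4 - (square_poly n ^+ 5)`_n + 2 * (square_poly n ^+ 6)`_n
  + 4 * z)).
rewrite hz hr h4 hy h2.
have -> : n%:Z = 4 * k%:Z by rewrite /n PoszM.
rewrite [128 * (x + _)]mulrDr; move: hx; move: (pos_square (2 * k))%:Z (pos_square n)%:Z => s t hx.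
have -> : 128 * x = 64 * (2 * x) by ring.
by rewrite -hx; ring.
Qed.

(** * The congruences *)

Section Final.

Variable l : nat.
Hypothesis l_prime : prime l.
Hypothesis l_odd : odd l.

Let L := l%:Z.

Definition at_div (f : nat -> int) (n : nat) : int :=
  if (l ^ 2 %| n)%N then f (n %/ l ^ 2)%N else 0.

Let l2_gt0 : (0 < l ^ 2)%N. Proof. by rewrite expn_gt0 prime_gt0. Qed.

Lemma r3_divE n : (r3_div l n)%:Z = at_div (fun m => (r3 m)%:Z) n.
Proof. by rewrite /r3_div /at_div; case: ifP. Qed.

Lemma prime_mod8 : exists k : int,
  [\/ [/\ L = 8 * k + 1, (2 ^ gamma l)%N = 128%N, legendre (-1) l = 1 & legendre 2 l = 1],
      [/\ L = 8 * k + 3, (2 ^ gamma l)%N = 32%N, legendre (-1) l = -1 & legendre 2 l = -1],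
      [/\ L = 8 * k + 5, (2 ^ gamma l)%N = 64%N, legendre (-1) l = 1 & legendre 2 l = -1] |
      [/\ L = 8 * k + 7, (2 ^ gamma l)%N = 64%N, legendre (-1) l = -1 & legendre 2 l = 1]].
Proof.
exists (l %/ 8)%N%:Z.
have -> : legendre (-1) l = (-1) ^+ odd l./2 by rewrite legendre_m1 // signr_odd.
have -> : legendre 2 l = (-1) ^+ odd (uphalf l./2) by rewrite legendre_2 // signr_odd.
rewrite /gamma.
have lE := divn_eq l 8.
have : [\/ l %% 8 = 1, l %% 8 = 3, l %% 8 = 5 | l %% 8 = 7]%N.
  have : (l %% 8 < 8)%N by rewrite ltn_mod.
  have : odd (l %% 8) by lia.
  case: (l %% 8)%N => [|[|[|[|[|[|[|[|]]]]]]]] //= _ _;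
    by [constructor 1|constructor 2|constructor 3|constructor 4].
case=> h; rewrite h /=; [constructor 1|constructor 2|constructor 3|constructor 4]; split=> //.
all: try by rewrite /L {1}lE h; lia.
- by have -> : odd l./2 = false by lia.
- by have -> : odd (uphalf l./2) = false by lia.
- by have -> : odd l./2 = true by lia.
- by have -> : odd (uphalf l./2) = true by lia.
- by have -> : odd l./2 = false by lia.
- by have -> : odd (uphalf l./2) = true by lia.
- by have -> : odd l./2 = true by lia.
- by have -> : odd (uphalf l./2) = false by lia.
Qed.

Lemma pos_square_mul_sqr n : pos_square (l ^ 2 * n) = pos_square n.
Proof.
have l0 := prime_gt0 l_prime.
apply/pos_squareP/pos_squareP => -[m m0 hm].
  have /dvdnP[j jm] : (l %| m)%N.
    have : (l %| m ^ 2)%N by rewrite -hm expnS -mulnA dvdn_mulr.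
    by rewrite Euclid_dvdX // andbT.
  exists j; first by rewrite jm muln_gt0 in m0; case/andP: m0.
  by apply/eqP; rewrite -(eqn_pmul2l l2_gt0) hm jm expnMn mulnC.
by exists (l * m)%N; rewrite ?muln_gt0 ?l0 // hm expnMn.
Qed.

Lemma dvdz_legendre0 (a : int) : (l %| a)%Z -> legendre a l = 0.
Proof. by rewrite /legendre => ->. Qed.

(* Applied with c = -1 to n, and with c = -2 to m where n = 2 m. *)
Lemma pos_square_cases (c : int) (n : nat) :
  [\/ pos_square n = false /\ at_div (fun m => (pos_square m)%:Z) n = 0,
      [/\ pos_square n = true, at_div (fun m => (pos_square m)%:Z) n = 1,
          legendre (c * n%:Z) l = 0 & (l ^ 2 %| n)%N] |
      [/\ pos_square n = true, at_div (fun m => (pos_square m)%:Z) n = 0,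
          legendre (c * n%:Z) l = legendre c l & (l ^ 2 %| n)%N = false]].
Proof.
rewrite /at_div; case: (boolP (l ^ 2 %| n)%N) => [/dvdnP[m ->]|hn].
  rewrite mulnK // mulnC pos_square_mul_sqr; case: (pos_square m); [constructor 2|by constructor 1].
  split=> //; apply: dvdz_legendre0.
  by rewrite PoszM expnS PoszM -mulrA mulrCA dvdz_mulr.
case: pos_squareP => [[m m0 nm]|]; [constructor 3|by constructor 1].
split=> //; rewrite legendreM // nm.
have -> : (m ^ 2)%N%:Z = m%:Z ^+ 2 by rewrite -[in RHS]natz -natrX natz.
rewrite legendre_sqr ?mulr1 // dvdzE /=; apply: contraNN hn => lm.
by rewrite nm dvdn_exp2r.
Qed.

(** Failure of the weight 3/2 Hecke relation with eigenvalue [1 + L]. It is linear in [f], so the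
    congruences for overpartitions can be inserted term by term. *)
Definition defect (chi : int) (f : nat -> int) (n : nat) : int :=
  f (l ^ 2 * n)%N + chi * f n + L * at_div f n - (1 + L) * f n.

Lemma r3_defect n : defect (legendre (- n%:Z) l) (fun m => (r3 m)%:Z) n = 0.
Proof. by rewrite /defect -r3_divE r3_hecke // subrr. Qed.

Let nr3 m := m%:Z * (r3 m)%:Z.

(** The weights at [l ^ 2 * n], [n] and [n / l^2] differ by factors L^2; eliminating
    [r3 (l ^ 2 * n)] by its relation leaves [L ^+ 2 - 1] as a common factor. *)
Lemma nr3_defect n : defect (legendre (- n%:Z) l) nr3 n =
  (L ^+ 2 - 1) * ((1 + L - legendre (- n%:Z) l) * nr3 n - L * (L ^+ 2 + 1) * at_div nr3 n).
Proof.
have := r3_defect n; rewrite /defect; set chi := legendre _ _ => h.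
have hE : (r3 (l ^ 2 * n))%:Z = (1 + L - chi) * (r3 n)%:Z - L * at_div (fun m => (r3 m)%:Z) n.
  by move: h; move: (at_div _ _) => x h; rewrite -[LHS]subr0 -[in LHS]h; ring.
have -> : nr3 (l ^ 2 * n) = L ^+ 2 * n%:Z * (r3 (l ^ 2 * n))%:Z.
  by rewrite /nr3 PoszM -[in LHS]natz natrX natz.
have nE : n%:Z * at_div (fun m => (r3 m)%:Z) n = L ^+ 2 * at_div nr3 n.
  rewrite /at_div; case: ifP => [/dvdnP[m ->]|_]; last by rewrite !mulr0.
  by rewrite mulnK // /nr3 PoszM -[(l ^ 2)%N%:Z]natz natrX natz; ring.
rewrite hE mulrBr [L ^+ 2 * n%:Z * (L * _)](_ : _ = L ^+ 3 * (n%:Z * at_div (fun m => (r3 m)%:Z)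
  n)); last by ring.
by rewrite nE /nr3; ring.
Qed.

Let sq m := (pos_square m)%:Z.
Let r3z m := (r3 m)%:Z.
Let nsq m := m%:Z * sq m.
Let npbar m := m%:Z * signed_pbar m.

Lemma at_div_dvd f n : (l ^ 2 %| n)%N -> (0 < n)%N ->
  exists2 m, (0 < m)%N & n = (l ^ 2 * m)%N /\ at_div f n = f m.
Proof.
move=> h n0; exists (n %/ l ^ 2)%N.
  by rewrite divn_gt0 // dvdn_leq.
by rewrite /at_div h mulnC divnK.
Qed.

Lemma at_div_ndvd f n : (l ^ 2 %| n)%N = false -> at_div f n = 0.
Proof. by rewrite /at_div => ->. Qed.

Lemma r3_even n : (0 < n)%N -> exists z, r3z n = 2 * z.
Proof.
move=> n0; rewrite /r3z (r3_expand (leqnn n) n0).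
by eexists (3 * _ + 6 * _ + 4 * _); rewrite !mulrDr !mulrA.
Qed.

Lemma Posz_sqr_mul m : (l ^ 2 * m)%N%:Z = L ^+ 2 * m%:Z.
Proof. by rewrite PoszM -[in LHS]natz natrX natz. Qed.

Lemma signed_pbar_hecke16 n : (0 < n)%N -> (16 %|
  L ^+ 3 * signed_pbar (l ^ 2 * n) + legendre (- n%:Z) l * L * signed_pbar n
  + at_div signed_pbar n - L ^+ 3 * (1 + L) * signed_pbar n)%Z.
Proof.
move=> n0.
have ln0 : (0 < l ^ 2 * n)%N by rewrite muln_gt0 l2_gt0.
have [z1 ->] := signed_pbar_mod16 ln0; have [z2 ->] := signed_pbar_mod16 n0.
have [z3 ->] : exists z, at_div signed_pbar n = 4 * at_div sq n - at_div r3z n + 16 * z.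
  case: (boolP (l ^ 2 %| n)%N) => [h|/negbTE h]; last by exists 0; rewrite !at_div_ndvd.
  have [m m0 [nm _]] := at_div_dvd sq h n0.
  have [z hz] := signed_pbar_mod16 m0; exists z.
  by rewrite /at_div h nm mulKn.
rewrite pos_square_mul_sqr -/(r3z _) -/(r3z n) -/(sq n).
have := r3_defect n; rewrite /defect -/r3z; set chi := legendre _ _ => h.
have -> : r3z (l ^ 2 * n) = (1 + L - chi) * r3z n - L * at_div r3z n.
  by move: h; rewrite -/(r3z _); move: (at_div _ _) => x h; rewrite -[LHS]subr0 -[in LHS]h; ring.
have [y ->] := r3_even n0.
have sqc := pos_square_cases (-1) n; rewrite mulN1r -/chi in sqc.
have [k hL] := prime_mod8.
have chi3 : chi * (L ^+ 2 - 1) = 8 * (chi * ((L ^+ 2 - 1) %/ 8)%Z).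
  rewrite mulrCA; congr (_ * _); rewrite mulrC divzK //.
  by case: hL => -[-> _ _ _]; lia.
pose e := ((L ^+ 4 - 1) %/ 16)%Z.
have L4 : L ^+ 4 = 1 + 16 * e.
  have : (16 %| L ^+ 4 - 1)%Z by case: hL => -[-> _ _ _]; lia.
  by move/divzK; rewrite -/e; lia.
(* If [n] is a square prime to [l], then [chi] is (-1 / l), which is congruent to [L] modulo 4; if
   l^2 divides it, [chi = 0] and the second term compensates the -1. *)
have [u hu] : exists u, sq n * (chi * L - 1) + at_div sq n = 4 * u.
  case: sqc => [[s0 s1]|[s0 s1 c0 _]|[s0 s1 c0 _]]; rewrite /sq s0 ?c0 s1 /=.
  - by exists 0; rewrite mul0r.
  - by exists 0; ring.
  - by case: hL => -[-> _ -> _]; [exists (2 * k)|exists (- 2 * k - 1)|exists (2 * k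
    + 1)|exists (- 2 * k - 2)]; ring.
move: (at_div r3z n) hu chi3; move: (sq n) (at_div sq n) (_ %/ 8)%Z => s s' d r' hu chi3.
apply/dvdzP; exists (u - s * 4 * e + chi * d * L * y + e * r' + L ^+ 3 * z1 + chi * L * z2 + z3
  - L ^+ 3 * (1 + L) * z2).
transitivity (4 * (s * (chi * L - 1) + s') - 4 * s * (L ^+ 4 - 1) + chi * (L ^+ 2 - 1) * L * 2 * y
   + (L ^+ 4 - 1) * r' + 16 * (L ^+ 3 * z1 + chi * L * z2 + z3 - L ^+ 3 * (1 + L) * z2));
     first by ring.
by rewrite hu chi3 L4; ring.
Qed.

Lemma nr3_mod8 n : (0 < n)%N -> exists w, nr3 n = 6 * nsq n + 8 * w.
Proof. by move=> n0; have [z h] := r3_mod8 n0; exists z; rewrite /nr3 h /nsq /sq; ring. Qed.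

Lemma at_div_nr3_mod8 n : (0 < n)%N -> exists w, at_div nr3 n = 6 * at_div nsq n + 8 * w.
Proof.
move=> n0; case: (boolP (l ^ 2 %| n)%N) => [h|/negbTE h]; last by exists 0; rewrite !at_div_ndvd.
have [m m0 [nm _]] := at_div_dvd sq h n0.
by have [w hw] := nr3_mod8 m0; exists w; rewrite /at_div h nm mulKn.
Qed.

Lemma at_div_nsq n : exists2 t, at_div nsq n = t * at_div sq n & (l ^ 2 %| n)%N -> n%:Z = L ^+ 2 *
  t.
Proof.
exists (n %/ l ^ 2)%N%:Z; first by rewrite /at_div; case: ifP => // _; rewrite mulr0.
by move=> h; rewrite -Posz_sqr_mul mulnC divnK.
Qed.

(** The error [8 * (L ^+ 2 - 1) * w] is harmless modulo 2^gamma: [L ^+ 2 - 1] is divisible by 8, and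
    by 16 when [l] is 1 or 7 modulo 8. *)
Lemma nr3_defect_square n : (0 < n)%N -> exists w,
  defect (legendre (- n%:Z) l) nr3 n = 8 * (L ^+ 2 - 1) * w +
  6 * (L ^+ 2 - 1) * ((1 + L - legendre (- n%:Z) l) * nsq n - L * (L ^+ 2 + 1) * at_div nsq n).
Proof.
move=> n0; rewrite nr3_defect.
have [w ->] := nr3_mod8 n0; have [w' ->] := at_div_nr3_mod8 n0.
exists ((1 + L - legendre (- n%:Z) l) * w - L * (L ^+ 2 + 1) * w').
by ring.
Qed.

Lemma npbar_defect_odd n : odd n ->
  ((2 ^ gamma l)%N %| defect (legendre (- n%:Z) l) npbar n)%Z.
Proof.
move=> no; have n0 : (0 < n)%N by rewrite odd_gt0.
have lno : odd (l ^ 2 * n) by rewrite oddM oddX l_odd no.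
(* As l^2 = 1 modulo 4, the factor [c] relating [r3] to [r122] is the same at [l ^ 2 * n], [n] and
   [n / l^2], so it cancels from the Hecke relation. *)
have mod4 m : odd m -> (l ^ 2 * m %% 4 == 1)%N = (m %% 4 == 1)%N.
  move=> mo; have : (l ^ 2 %% 4 = 1)%N.
    have [j ->] : exists j, l = (2 * j + 1)%N by exists l./2; lia.
    by have -> : ((2 * j + 1) ^ 2 = (j ^ 2 + j) * 4 + 1)%N; [lia|rewrite modnMDl].
  by move=> h; rewrite -modnMml h mul1n.
set chi := legendre _ _; pose chi2 := legendre (- (2 * n)%N%:Z) l.
have [a [b [[z hz] ha [wa hwa] hb]]] := signed_pbar_odd no.
have [a1 [b1 [[z1 hz1] ha1 _ hb1]]] := signed_pbar_odd lno.
rewrite mod4 // in hb1; set c := (if _ then 3 else 1) in hb hb1.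
have [a' [b' [z' [hz' ha' hb']]]] : exists a' b' z', [/\
    at_div npbar n = - at_div nr3 n + 4 * a' - 4 * b' + 4 * at_div nsq n - 8 * at_div sq n
      + 128 * z',
    at_div r3z (2 * n) = 3 * a' & at_div r3z n = c * b'].
  case: (boolP (l ^ 2 %| n)%N) => [h|/negbTE h]; last first.
    exists 0, 0, 0; rewrite !at_div_ndvd ?mulr0 ?subr0 ?addr0 ?oppr0 //.
    by rewrite Gauss_dvdr // coprimeXl // coprimen2.
  have [m m0 [nm _]] := at_div_dvd sq h n0.
  have mo : odd m by move: no; rewrite nm oddM => /andP[].
  have [a' [b' [[z' hz'] ha' _ hb']]] := signed_pbar_odd mo.
  exists a', b', z'; rewrite /at_div dvdn_mull // h nm mulKn // mulnCA mulKn //.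
  split; [|exact: ha'|by rewrite /r3z hb' /c nm mod4].
  by rewrite /npbar hz' /nr3 /nsq /sq; ring.
have da : a1 + chi2 * a + L * a' = (1 + L) * a.
  have := r3_defect (2 * n); rewrite /defect -/r3z -/chi2 ha' mulnCA /r3z ha ha1 => h.
  by apply: (@mulfI _ 3) => //; apply/eqP; rewrite -subr_eq0 -h; apply/eqP; ring.
have db : b1 + chi * b + L * b' = (1 + L) * b.
  have := r3_defect n; rewrite /defect -/r3z -/chi hb' /r3z hb hb1 => h.
  apply: (@mulfI _ c); first by rewrite /c; case: ifP.
  by apply/eqP; rewrite -subr_eq0 -h; apply/eqP; ring.
have [w hw] := nr3_defect_square n0; rewrite -/chi in hw.
have -> : defect chi npbar n = - defect chi nr3 n + 4 * (chi - chi2) * a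
   + ((4 * L ^+ 2 * n%:Z - 8) * sq n + chi * (4 * n%:Z - 8) * sq n
      + L * (4 * at_div nsq n - 8 * at_div sq n) - (1 + L) * (4 * n%:Z - 8) * sq n)
   + 128 * (z1 + chi * z + L * z' - (1 + L) * z).
  rewrite /defect hz' /npbar hz hz1 -/(nr3 _) pos_square_mul_sqr Posz_sqr_mul -/(sq n).
  have -> : a1 = (1 + L) * a - chi2 * a - L * a' by rewrite -da; ring.
  have -> : b1 = (1 + L) * b - chi * b - L * b' by rewrite -db; ring.
  by rewrite /nr3 Posz_sqr_mul; ring.
rewrite hw hwa /nsq -/(sq n) -/nsq.
(* Hence [4 * (chi - chi2) * a] is 0 or [8 * chi * a], and the latter is [32 * chi * sq n] modulo 64
   because [a] is [4 * sq n] modulo 8. *)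
have chi2E : chi2 = chi * legendre 2 l.
  by rewrite /chi -legendreM // /chi2; congr legendre; rewrite PoszM; ring.
have chi_range := legendre_range l (- n%:Z); rewrite -/chi in chi_range.
have [t -> ht] := at_div_nsq n.
have sqc := pos_square_cases (-1) n; rewrite mulN1r -/chi -/(sq _) in sqc.
have [k hL] := prime_mod8.
move: (z1 + chi * z + L * z' - (1 + L) * z) => Z; rewrite chi2E -/(sq n).
have n8 : pos_square n -> exists j : int, n%:Z = 8 * j + 1.
  move=> /pos_square_mod8 h; exists (n %/ 8)%N%:Z; move: (h) no; clear=> h no.
  by have /h : ~~ (4 %| n)%N; lia.
move: ht n8 sqc; rewrite -/sq /sq;
  move: (n%:Z) (at_div (fun m => (pos_square m)%:Z) n) => N s' ht n8 sqc.
case: sqc => [[s0 s1]|[s0 s1 c0 h]|[s0 s1 c0 _]]; rewrite s0 s1 ?c0 /=.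
- case: hL => -[-> -> _ ->]; case: chi_range => ->; clear; lia.
- rewrite ht //; case: hL => -[-> -> _ _]; clear; lia.
- have [j ->] := n8 s0; case: hL => -[-> -> -> ->]; clear; lia.
Qed.

(** Twice an odd number is not a square, so the only square term is the one at [m], with coefficient
    32. For a square [m] prime to [l] it contributes [32 * (chi - L)] with [chi] equal to (-2 /
    l). *)
Lemma npbar_defect_2mod4 m : odd m ->
  ((2 ^ gamma l)%N %| defect (legendre (- (2 * m)%N%:Z) l) npbar (2 * m))%Z.
Proof.
move=> mo; set n := (2 * m)%N; have m0 : (0 < m)%N by rewrite odd_gt0.
have n0 : (0 < n)%N by rewrite /n muln_gt0.
have lmo : odd (l ^ 2 * m) by rewrite oddM oddX l_odd mo.
have lnE : (l ^ 2 * n = 2 * (l ^ 2 * m))%N by rewrite /n mulnCA.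
have l2n : (l ^ 2 %| n)%N = (l ^ 2 %| m)%N.
  by rewrite /n Gauss_dvdr // coprimeXl // coprimen2.
set chi := legendre _ _.
have [z hz] := signed_pbar_2mod4 mo; have [z1 hz1] := signed_pbar_2mod4 lmo.
rewrite -/n in hz; rewrite -lnE in hz1.
have [z' hz'] : exists z', at_div npbar n = - at_div nr3 n + 32 * at_div sq m + 128 * z'.
  case: (boolP (l ^ 2 %| m)%N) => [h|/negbTE h]; last first.
    by exists 0; rewrite !at_div_ndvd ?l2n.
  have [j j0 [mj _]] := at_div_dvd sq h m0.
  have jo : odd j by move: mo; rewrite mj oddM => /andP[].
  have [z' hz'] := signed_pbar_2mod4 jo; exists z'.
  rewrite /at_div l2n h /n mj mulnCA !mulKn //.
  by rewrite /npbar hz' /nr3 /sq; ring.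
have [w hw] := nr3_defect_square n0; rewrite -/chi in hw.
have sn0 : nsq n = 0.
  rewrite /nsq /sq; case: (boolP (pos_square n)) => [/pos_square_mod4|]; last by rewrite mulr0.
  by rewrite /n; move: mo; clear; lia.
have sn0' : at_div nsq n = 0.
  case: (boolP (l ^ 2 %| m)%N) => [h|/negbTE h]; last by rewrite !at_div_ndvd ?l2n.
  have [j j0 [mj _]] := at_div_dvd sq h m0.
  rewrite /at_div l2n h; suff -> : nsq (n %/ l ^ 2) = 0 by [].
  have -> : (n %/ l ^ 2 = 2 * j)%N by rewrite /n mj mulnCA mulKn.
  rewrite /nsq /sq; case: (boolP (pos_square _)) => [/pos_square_mod4|]; last by rewrite mulr0.
  by move: mo; rewrite mj oddM => /andP[_]; clear; lia.
have -> : defect chi npbar n = - defect chi nr3 n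
   + 32 * ((1 + chi - (1 + L)) * sq m + L * at_div sq m) + 128 * (z1 + chi * z + L * z' - (1
     + L) * z).
  rewrite /defect hz' /npbar hz hz1 pos_square_mul_sqr -/(sq m) -/(r3z _) /nr3 -/(r3z _).
  by ring.
rewrite hw sn0 sn0'.
have sqc := pos_square_cases (-2) m.
have chiE : legendre (-2 * m%:Z) l = chi.
  by rewrite /chi /n PoszM; congr legendre; ring.
have m2E : legendre (-2) l = legendre (-1) l * legendre 2 l by rewrite -legendreM.
rewrite chiE m2E -/sq in sqc.
have [k hL] := prime_mod8.
move: (z1 + chi * z + L * z' - (1 + L) * z) => Z.
case: sqc => [[s0 s1]|[s0 s1 c0 h]|[s0 s1 c0 _]]; rewrite s1 /sq s0 ?c0 /=.
- by case: hL => -[-> -> _ _]; clear; lia.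
- by case: hL => -[-> -> _ _]; clear; lia.
- by case: hL => -[-> -> -> ->]; clear; lia.
Qed.

Lemma npbar_defect_0mod4 k : (0 < k)%N ->
  ((2 ^ gamma l)%N %| defect (legendre (- (4 * k)%N%:Z) l) npbar (4 * k))%Z.
Proof.
move=> k0; set n := (4 * k)%N; have n0 : (0 < n)%N by rewrite /n muln_gt0.
have lk0 : (0 < l ^ 2 * k)%N by rewrite muln_gt0 l2_gt0.
have lnE : (l ^ 2 * n = 4 * (l ^ 2 * k))%N by rewrite /n mulnCA.
have l2n : (l ^ 2 %| n)%N = (l ^ 2 %| k)%N.
  by rewrite /n Gauss_dvdr // coprimeXl // (coprimeXr 2 (_ : coprime l 2)) // coprimen2.
set chi := legendre _ _.
have [z hz] := signed_pbar_0mod4 k0; have [z1 hz1] := signed_pbar_0mod4 lk0.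
rewrite -/n in hz; rewrite -lnE in hz1.
have [z' hz'] : exists z', at_div npbar n = - at_div nr3 n + 20 * at_div nsq n + 128 * z'.
  case: (boolP (l ^ 2 %| k)%N) => [h|/negbTE h]; last first.
    by exists 0; rewrite !at_div_ndvd ?l2n.
  have [j j0 [mj _]] := at_div_dvd sq h k0.
  have [z' hz'] := signed_pbar_0mod4 j0; exists z'.
  rewrite /at_div l2n h /n mj mulnCA !mulKn //.
  by rewrite /npbar hz' /nr3 /nsq /sq; ring.
have [w hw] := nr3_defect_square n0; rewrite -/chi in hw.
have -> : defect chi npbar n = - defect chi nr3 n
   + 20 * (L ^+ 2 * n%:Z * sq n + chi * n%:Z * sq n + L * at_div nsq n - (1 + L) * n%:Z * sq n)
   + 128 * (z1 + chi * z + L * z' - (1 + L) * z).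
  rewrite /defect hz' /npbar hz hz1 pos_square_mul_sqr /nr3 Posz_sqr_mul /sq.
  by ring.
rewrite hw /nsq -/nsq.
have [t -> ht] := at_div_nsq n.
have sqc := pos_square_cases (-1) n; rewrite mulN1r -/chi -/(sq _) in sqc.
have [j hL] := prime_mod8.
move: (z1 + chi * z + L * z' - (1 + L) * z) => Z.
have nE : n%:Z = 4 * k%:Z by rewrite /n PoszM.
move: ht nE sqc; rewrite -/sq /sq;
  move: (n%:Z) (at_div (fun m => (pos_square m)%:Z) n) => N s' ht nE sqc.
case: sqc => [[s0 s1]|[s0 s1 c0 h]|[s0 s1 c0 _]]; rewrite s0 s1 ?c0 /=.
- by case: hL => -[-> -> _ _]; clear; lia.
- by rewrite ht //; case: hL => -[-> -> _ _]; clear; lia.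
- by rewrite nE; case: hL => -[-> -> -> _]; clear; lia.
Qed.

End Final.

Lemma pbarq_div (d n : nat) : (0 < d)%N ->
  pbarq (n%:R / d%:R) = if (d %| n)%N then pbar (n %/ d) else 0%N.
Proof.
move=> d0; have dq : (d%:R : rat) != 0 by rewrite pnatr_eq0 -lt0n.
rewrite /pbarq; case: natrP => [[m hm]|h].
  have nE : n = (m * d)%N.
    by apply/eqP; rewrite -(eqr_nat rat) natrM -hm divfK.
  by rewrite hm natrK nE dvdn_mull // mulnK.
case: ifP => // /dvdnP[m nm]; case: h; exists m.
by rewrite nm natrM mulfK.
Qed.

Lemma Zp_intr0 (m : nat) (x : int) : (1 < m)%N -> (m %| x)%Z -> x%:~R = 0 :> 'Z_m.
Proof.
by move=> m1 /dvdzP[k ->]; rewrite rmorphM /= -[m%:Z%:~R]/(m%:R) pchar_Zp // mulr0.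
Qed.

Theorem theorem1p4 (l : nat) (l_prime : prime l) (l_odd : odd l) (n : nat) :
  (pbar (l ^ 2 * n))%:R
    + (legendre (- n%:Z) l)%:~R * l%:R ^- 2 * (pbar n)%:R
    + l%:R ^- 3 * (pbarq (n%:R / l%:R ^+ 2))%:R
  = (1 + l%:R) * (pbar n)%:R :> 'Z_16
  /\
  l%:R ^+ 2 * n%:R * (pbar (l ^ 2 * n))%:R
    + (legendre (- n%:Z) l)%:~R * n%:R * (pbar n)%:R
    + l%:R^-1 * n%:R * (pbarq (n%:R / l%:R ^+ 2))%:R
  = (1 + l%:R) * n%:R * (pbar n)%:R :> 'Z_(2 ^ gamma l).
Proof.
have l2_gt0 : (0 < l ^ 2)%N by rewrite expn_gt0 prime_gt0.
have unit m : (1 < m)%N -> coprime m l -> (l%:R : 'Z_m) \is a GRing.unit.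
  by move=> m1 cm; rewrite unitZpE.
have co k : coprime (2 ^ k) l by rewrite coprimeXl // coprime2n.
have g1 : (1 < 2 ^ gamma l)%N.
  by have [k [] []] := prime_mod8 l_prime l_odd => _ ->.
rewrite -(natrX rat) !pbarq_div //; set q := (if _ then _ else _).
(* Since [l] is odd, the sign in [signed_pbar] is common to all terms and can be divided out. *)
have sgnl m : (-1) ^+ (l ^ 2 * m) = (-1) ^+ m :> int.
  by rewrite -signr_odd oddM oddX l_odd /= signr_odd.
have sgn (x : int) (d : nat) : (d %| (-1) ^+ n * x)%Z -> (d %| x)%Z.
  by rewrite -signr_odd; case: odd; rewrite ?expr0 ?mul1r // expr1 mulN1r rpredN.
have sgndiv : at_div l signed_pbar n = (-1) ^+ n * q%:Z.
  rewrite /q /at_div; case: ifP => [/dvdnP[m ->]|_]; last by rewrite mulr0.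
  by rewrite mulnK // /signed_pbar [(m * _)%N]mulnC sgnl.
set chi := legendre _ _; split.
  have ul : (l%:R : 'Z_16) \is a GRing.unit := unit 16%N isT (co 4).
  suff : (16 %| l%:Z ^+ 3 * (pbar (l ^ 2 * n))%:Z + chi * l%:Z * (pbar n)%:Z + q%:Z
     - l%:Z ^+ 3 * (1 + l%:Z) * (pbar n)%:Z)%Z.
    move/(@Zp_intr0 16 _ isT)/eqP; rewrite rmorphB subr_eq0 !(rmorphD, rmorphM, rmorphXn) /=.
    rewrite -!pmulrn rmorph1 => /eqP E.
    apply: (mulrI (unitrX 3 ul)); rewrite [RHS]mulrA -[RHS]E -!exprVn.
    have := mulrV ul; move: (l%:R^-1) => v uv.
    transitivity (l%:R ^+ 3 * (pbar (l ^ 2 * n))%:R + chi%:~R * (l%:R * v) ^+ 2 * l%:R * (pbar n)%:R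
      + (l%:R * v) ^+ 3 * q%:R : 'Z_16); first by ring.
    by rewrite uv; ring.
  (* The expansions need [n > 0]. At 0 all three values of [pbar] agree and the symbol is 0, so the
     claim becomes [l^4 = 1] modulo 16. *)
  case: (posnP n) => [n0|n0].
    have -> : pbar (l ^ 2 * n) = pbar n by rewrite n0 muln0.
    have -> : q = pbar n by rewrite /q n0 dvdn0 div0n.
    have -> : chi = 0 by rewrite /chi n0 dvdz_legendre0.
    have h16 : (16 %| l%:Z ^+ 4 - 1)%Z.
      by have [k []] := prime_mod8 l_prime l_odd => -[-> _ _ _]; lia.
    by apply: (dvdz_lin1 (f := - (pbar n)%:Z) h16); ring.
  apply: sgn; have := signed_pbar_hecke16 l_prime l_odd n0.
  by rewrite sgndiv /signed_pbar sgnl -/chi; congr (_ \in dvdz _); ring.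
(* For [n = l^2 m] the term with the inverse of [l] is [l m pbar(m)], so the second congruence is
   the Hecke relation for [m pbar(m)] and its inverse disappears. *)
suff : ((2 ^ gamma l)%N %| l%:Z ^+ 2 * n%:Z * (pbar (l ^ 2 * n))%:Z + chi * n%:Z * (pbar n)%:Z
   + l%:Z * at_div l (fun m => m%:Z * (pbar m)%:Z) n - (1 + l%:Z) * n%:Z * (pbar n)%:Z)%Z.
  move/(Zp_intr0 g1)/eqP; rewrite rmorphB subr_eq0 !(rmorphD, rmorphM, rmorphXn) /=.
  rewrite -!pmulrn rmorph1 => /eqP <-; congr (_ + _).
  rewrite /q /at_div; case: ifP => [/dvdnP[m ->]|_]; last by rewrite !mulr0.
  rewrite mulnK // natrM natrX rmorphM /= -!pmulrn.
  have ul : (l%:R : 'Z_(2 ^ gamma l)) \is a GRing.unit := unit _ g1 (co _).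
  have := mulVr ul; move: (l%:R^-1) => v uv.
  transitivity ((v * l%:R) * l%:R * (m%:R * (pbar m)%:R) : 'Z_(2 ^ gamma l)); first by ring.
  by rewrite uv mul1r.
case: (posnP n) => [n0|n0].
  rewrite /at_div n0 dvdn0 div0n; rewrite !(mulr0, mul0r, addr0, subr0).
  exact: dvdz0.
apply: sgn.
have -> : (-1) ^+ n * (l%:Z ^+ 2 * n%:Z * (pbar (l ^ 2 * n))%:Z + chi * n%:Z * (pbar n)%:Z
   + l%:Z * at_div l (fun m => m%:Z * (pbar m)%:Z) n - (1 + l%:Z) * n%:Z * (pbar n)%:Z) =
   defect l chi (fun m => m%:Z * signed_pbar m) n.
  have E : at_div l (fun m => m%:Z * signed_pbar m) n =
      (-1) ^+ n * at_div l (fun m => m%:Z * (pbar m)%:Z) n.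
    rewrite /at_div; case: ifP => [/dvdnP[m ->]|_]; last by rewrite mulr0.
    by rewrite mulnK // /signed_pbar [(m * _)%N]mulnC sgnl mulrCA.
  by rewrite /defect E /signed_pbar sgnl Posz_sqr_mul //; ring.
case: (boolP (odd n)) => no; first exact: npbar_defect_odd.
have [[m mo nm]|[k k0 nk]] : (exists2 m, odd m & n = (2 * m)%N) \/ (exists2 k, (0 < k)%N & n = (4
  * k)%N).
  case: (boolP (odd n./2)) => n2; [left; exists n./2 => //; lia|right; exists (n %/ 4)%N; lia].
- by rewrite /chi nm; apply: npbar_defect_2mod4.
- by rewrite /chi nk; apply: npbar_defect_0mod4.
Qed.
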